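(* Let $1\le r<\infty$, let $s,t$ satisfy $0<s\le1/2$, $1/2<t<1-s$ and $2^r\frac{s}{1-t}<1$, and let $T$ be a linear operator that satisfies the splitting property with parameter $s$ and $M_T=M_r$ (see context). Then, for $0<p<r$, every cube $Q_0$, $x\in Q_0$, and $f$ in the class $\mathcal{S}$ of the splitting property, $$M^{\sharp}_{p,Q_0}(Tf)(x)\le c_p\sup_{x\in Q,\,Q\subset Q_0}\ \inf_{y\in Q}M_rf(y),$$ with $c_p\to\infty$ as $p\to r$, and, consequently, $$M^{\sharp}_p(Tf)(x)\le c_p\,M_rf(x),$$ with the same $c_p$. Furthermore, $$M^{\sharp}_r(Tf)(x)\le c\,M_{L^r\log L}f(x).$$
   Context: All cubes have sides parallel to the axes. $M$ is the Hardy-Littlewood maximal operator and $M_rf=M(|f|^r)^{1/r}$. For $0<p<\infty$, $$M^{\sharp}_pg(x)=\sup_{x\in Q}\inf_c\Big(\frac{1}{|Q|}\int_Q|g(y)-c|^p\,dy\Big)^{1/p},$$ and $M^{\sharp}_{p,Q_0}g(x)$, $x\in Q_0$, is defined in the same way with the supremum restricted to cubes $Q$ with $x\in Q\subset Q_0$. $M_{L^r\log L}f(x)=\sup_{x\in Q}\|f\|_{L^B(Q)}$ with $B(\tau)=\tau^r\log(1+\tau)$, where $\|f\|_{L^B(Q)}=\inf\{\lambda>0:\frac{1}{|Q|}\int_QB(|f(y)|/\lambda)\,dy\le1\}$. The constants $c_p$, $c$ are independent of $f$, $x$ and $Q_0$. Splitting property with parameter $s$ and mapping $M_T$: there are constants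 $c_1',c_2'>0$ and a dense class $\mathcal{S}$ of functions of the domain of $T$ such that for every cube $Q_0$ and any cube $Q\subset Q_0$ there exists $x_Q\in Q$ such that every $f\in\mathcal{S}$ can be written as $f=f_1+f_2$ (the decomposition may depend on $Q$) with $|\{z\in Q:|Tf_1(z)|>c_1'\inf_{y\in Q}M_Tf(y)\}|<s|Q|$ and $\|Tf_2-Tf_2(x_Q)\|_{L^\infty(Q)}\le c_2'\inf_{y\in Q}M_Tf(y)$. *)

(* Defs.v *)
From HB Require Import structures.
From mathcomp Require Import all_boot all_order all_algebra.
From mathcomp Require Import all_classical all_reals all_analysis.

Set Implicit Arguments.
Unset Strict Implicit.
Unset Printing Implicit Defensive.

Import Order.TTheory GRing.Theory Num.Theory.
Import numFieldNormedType.Exports.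

Local Open Scope classical_set_scope.
Local Open Scope ring_scope.

(* Lebesgue measure on R^n: iterated product of the one-dimensional measure on
   the Borel sets of n-tuples, then completed by the Caratheodory extension. *)

Section cons_measure.
Context {R : realType} (n : nat).
Notation RT := (measurableTypeR R).
Local Open Scope ereal_scope.
Variable nu : {sigma_finite_measure set (n.-tuple RT) -> \bar R}.

Definition cons_pair (x : RT * n.-tuple RT) : n.+1.-tuple RT :=
  [tuple of x.1 :: x.2].

Definition uncons (t : n.+1.-tuple RT) : RT * n.-tuple RT :=
  (thead t, [tuple of behead t]).

Lemma cons_pairK : cancel cons_pair uncons.
Proof.
by move=> [x t]; rewrite /uncons /cons_pair theadE; congr (_, _); exact: val_inj.
Qed.

Lemma unconsK : cancel uncons cons_pair.
Proof. by move=> t; rewrite [RHS]tuple_eta; exact: val_inj. Qed.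

Lemma measurable_cons_pair : measurable_fun [set: _] cons_pair.
Proof. exact: measurable_cons. Qed.

Lemma measurable_uncons : measurable_fun [set: _] uncons.
Proof.
apply/measurable_fun_pairP; split => /=; first exact: measurable_tnth.
exact: measurable_behead.
Qed.

Definition cons_measure : set (n.+1.-tuple RT) -> \bar R :=
  pushforward ((@lebesgue_measure R) \x nu) cons_pair.

Let cons_measure0 : cons_measure set0 = 0.
Proof. by rewrite /cons_measure /pushforward preimage_set0 measure0. Qed.

Let cons_measure_ge0 A : 0 <= cons_measure A.
Proof. by rewrite /cons_measure /pushforward. Qed.

Let measurable_preim A : measurable A -> measurable (cons_pair @^-1` A).
Proof. by move=> mA; rewrite -[X in measurable X]setTI; exact: measurable_cons_pair. Qed.

Let cons_measure_sigma_additive : semi_sigma_additive cons_measure.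
Proof.
move=> F mF tF mUF; rewrite /cons_measure /pushforward preimage_bigcup.
apply: measure_semi_sigma_additive.
- by move=> k; exact: measurable_preim.
- apply/trivIsetP => /= i j _ _ ij; rewrite -preimage_setI.
  by move/trivIsetP : tF => /(_ _ _ _ _ ij) ->//; rewrite preimage_set0.
- by rewrite -preimage_bigcup; exact: measurable_preim.
Qed.

HB.instance Definition _ := isMeasure.Build _ _ _ cons_measure
  cons_measure0 cons_measure_ge0 cons_measure_sigma_additive.

Let cons_measure_sigma_finite : sigma_finite setT cons_measure.
Proof.
have /sigma_finiteP[F [TF ndF Foo]] := sigma_finiteT (@lebesgue_measure R).
have /sigma_finiteP[G [TG ndG Goo]] := sigma_finiteT nu.
exists (fun k => uncons @^-1` (F k `*` G k)).
  apply/seteqP; split => // t _.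
  have [i _ Fi] : (\bigcup_i F i) (uncons t).1 by rewrite -TF.
  have [j _ Gj] : (\bigcup_i G i) (uncons t).2 by rewrite -TG.
  exists (maxn i j) => //; split.
  - by apply: subsetPset Fi; exact/ndF/leq_maxl.
  - by apply: subsetPset Gj; exact/ndG/leq_maxr.
move=> k; have [mF Fkoo] := Foo k; have [mG Gkoo] := Goo k; split.
  by rewrite -[X in measurable X]setTI; apply: measurable_uncons => //;
    exact: measurableX.
rewrite /cons_measure /pushforward -comp_preimage.
rewrite (_ : uncons \o cons_pair = id) ?preimage_id//; last first.
  by apply/funext => x; rewrite /= cons_pairK.
by rewrite product_measure1E// lte_mul_pinfty// ge0_fin_numE.
Qed.

HB.instance Definition _ := Measure_isSigmaFinite.Build _ _ _ cons_measure
  cons_measure_sigma_finite.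

End cons_measure.

Fixpoint borel_lebesgue (R : realType) (n : nat) :
    {sigma_finite_measure set (n.-tuple (measurableTypeR R)) -> \bar R} :=
  if n is m.+1 then cons_measure (borel_lebesgue R m)
  else (\d_[tuple] : {measure set _ -> \bar R}).

Section borel_cube.
Context {R : realType}.
Notation RT := (measurableTypeR R).

Definition tuple_cube (n : nat) (a : n.-tuple R) (l : R) : set (n.-tuple RT) :=
  [set t | forall i : 'I_n, tnth a i <= tnth t i <= tnth a i + l].

Lemma cons_preimage_cube (n : nat) (a l : R) (b : n.-tuple R) :
  @cons_pair R n @^-1` tuple_cube [tuple of a :: b] l
  = `[a, a + l]%classic `*` tuple_cube b l.
Proof.
apply/seteqP; split => -[x t] /=.
  move=> h; split; first by have := h ord0; rewrite in_itv/= !tnth0.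
  by move=> i; have := h (lift ord0 i); rewrite !tnthS.
rewrite in_itv /= => -[h0 h] i.
case: (unliftP ord0 i) => [j ->|->]; first by rewrite !tnthS.
by rewrite !tnth0.
Qed.

Lemma measurable_tuple_cube (n : nat) (a : n.-tuple R) (l : R) :
  measurable (tuple_cube a l).
Proof.
rewrite (_ : tuple_cube a l = \big[setI/setT]_(i < n)
    ((fun t : n.-tuple RT => tnth t i) @^-1` `[tnth a i, tnth a i + l]%classic)).
  apply: bigsetI_measurable => i _; rewrite -[X in measurable X]setTI.
  by apply: measurable_tnth.
apply/seteqP; split => t.
  by move=> h; rewrite -bigcap_seq => i _ /=; rewrite in_itv; exact: h.
rewrite -bigcap_seq => h i.
by have /= := h i (mem_index_enum i); rewrite in_itv.
Qed.

Lemma borel_lebesgue_cube (n : nat) (a : n.-tuple R) (l : R) : 0 <= l ->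
  borel_lebesgue R n (tuple_cube a l) = (l ^+ n)%:E.
Proof.
move=> l0; elim: n a => [|n IH] a.
  by rewrite /= diracE expr0 mem_set// => -[].
case/tupleP: a => a b; rewrite /= /cons_measure /pushforward cons_preimage_cube.
rewrite product_measure1E//; last exact: measurable_tuple_cube.
have itvE : (@lebesgue_measure R) `[a, a + l]%classic = l%:E.
  rewrite lebesgue_measure_itv /= lte_fin ltrDl.
  case: ltgtP l0 => // [_ _|<- _//].
  by rewrite -EFinB addrAC subrr add0r.
by rewrite exprS EFinM; congr (_ * _)%E; [exact: itvE|exact: IH].
Qed.

End borel_cube.

(* The Lebesgue measurable space R^n, whose points are n-tuples of reals. *)
Definition Rn (R : realType) (n : nat) : measurableType _ :=
  caratheodory_type (mu_ext (borel_lebesgue R n)).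

Definition lebesgue (R : realType) (n : nat) : set (Rn R n) -> \bar R :=
  @completed_measure_extension _ _ _ (borel_lebesgue R n).

HB.instance Definition _ (R : realType) (n : nat) :=
  Measure.on (@lebesgue R n).

Lemma lebesgue_cube (R : realType) (n : nat) (a : n.-tuple R) (l : R) :
  0 <= l -> measurable (tuple_cube a l : set (Rn R n)) /\
  @lebesgue R n (tuple_cube a l) = (l ^+ n)%:E.
Proof.
move=> l0; have mC := measurable_tuple_cube a l; split.
  exact: caratheodory_measurable_mu_ext.
rewrite -(borel_lebesgue_cube a l0); exact: measurable_mu_extE.
Qed.

Section operators.
Context {R : realType} {n : nat}.
Notation E := (Rn R n).
Notation mu := (@lebesgue R n).
Implicit Types (Q : set E) (g : E -> R) (x : E).
Local Open Scope ereal_scope.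

Definition cube : set (set E) :=
  [set Q | exists (a : n.-tuple R) (l : R), (0 < l)%R /\ Q = tuple_cube a l].

Definition average Q (h : E -> R) : \bar R :=
  ((fine (mu Q))^-1)%:E * \int[mu]_(y in Q) (h y)%:E.

Definition maximal g x : \bar R :=
  ereal_sup [set average Q (fun y => `|g y|%R) | Q in cube `&` [set Q | Q x]].

Definition maximal_pow (r : R) g x : \bar R :=
  maximal (fun y => `|g y| `^ r)%R x `^ r^-1.

Definition oscillation (p : R) g Q : \bar R :=
  ereal_inf [set average Q (fun y => `|g y - c| `^ p)%R `^ p^-1 | c in [set: R]].

Definition sharp (p : R) g x : \bar R :=
  ereal_sup [set oscillation p g Q | Q in cube `&` [set Q | Q x]].

Definition local_sharp (p : R) (Q0 : set E) g x : \bar R :=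
  ereal_sup
    [set oscillation p g Q | Q in cube `&` [set Q | Q x] `&` [set Q | Q `<=` Q0]].

Definition luxemburg (B : R -> R) g Q : \bar R :=
  ereal_inf [set lam%:E | lam in
    [set lam : R | (0 < lam)%R /\ average Q (fun y => B (`|g y| / lam)%R) <= 1]].

Definition young_LrlogL (r tau : R) : R := (tau `^ r * ln (1 + tau))%R.

Definition maximal_LrlogL (r : R) g x : \bar R :=
  ereal_sup [set luxemburg (young_LrlogL r) g Q | Q in cube `&` [set Q | Q x]].

Definition inf_on Q (h : E -> \bar R) : \bar R := ereal_inf [set h y | y in Q].

Definition Linfty_norm Q g : \bar R := 'N[mu]_+oo[ (EFin \o g) \_ Q ].

End operators.

Section operator_classes.
Context {R : realType} {n : nat}.
Notation E := (Rn R n).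
Notation mu := (@lebesgue R n).
Variable X : topologicalLmodType R.
Local Open Scope ereal_scope.

(* Equality of measurable functions is meant almost everywhere, so linearity is
   too; pointwise linear maps are included. *)
Definition ae_linear (T : X -> E -> R) : Prop :=
  forall (a : R) (f g : X),
    {ae mu, forall z, T (a *: f + g)%R z = (a * T f z + T g z)%R}.

Definition linear_operator (T : X -> E -> R) : Prop :=
  (forall f, measurable_fun [set: E] (T f)) /\ ae_linear T.

(* [X] is a topological vector space of measurable functions: [ev f] is the
   function (or, for a space of classes modulo null sets, a representative of
   the class) underlying [f]. *)
Definition function_space (ev : X -> E -> R) : Prop :=
  [/\ injective ev, forall f, measurable_fun [set: E] (ev f) & ae_linear ev].

Definition splitting_property (ev T : X -> E -> R) (s : R)
    (MT : (E -> R) -> E -> \bar R) (S : set X) : Prop :=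
  dense S /\
  exists c1 c2 : R, [/\ (0 < c1)%R, (0 < c2)%R &
    forall Q0 Q : set E, cube Q0 -> cube Q -> Q `<=` Q0 ->
    exists2 xQ : E, Q xQ &
    forall f : X, S f ->
    exists f1 f2 : X, [/\ f = (f1 + f2)%R,
      mu [set z | Q z /\ c1%:E * inf_on Q (MT (ev f)) < `|T f1 z|%:E]
        < s%:E * mu Q &
      Linfty_norm Q (fun z => T f2 z - T f2 xQ)%R
        <= c2%:E * inf_on Q (MT (ev f))]].

End operator_classes.

(* Main.v *)
Require Import Defs.
From mathcomp Require Import all_boot all_order all_algebra.
From mathcomp Require Import all_classical all_reals all_analysis.
From mathcomp Require Import measurable_realfun ess_sup_inf ring lra zify.

(** Write g = T f. The splitting property gives, on every cube Q, a constant c_Q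
with |g - c_Q| <= (c1 + c2) inf_Q M_r f outside a subset of measure at most
s |Q| ([splitting_weak_oscillation]). This weak information is upgraded to an
L^p estimate on a fixed cube Q0 by stopping times.

Walk down the dyadic subcubes of Q0 and stop at the first cubes Q on which c_Q
differs from c_Q0 by more than the two infima together. On such a Q all but a
proportion s of the points are exceptional for Q0, so the stopped cubes fill at
most a fraction s / (1 - s) of Q0 ([stopping_mass]). The parent of Q did not
stop, and neighbouring generations have nearby constants ([child_constant]), so
c_Q - c_Q0 is at most a multiple of inf_Q M_r f. Restarting on each stopped
cube, at a point reached by k restarts |g - c_Q0| is bounded by a sum of k + 1
infima. Such a sum costs a factor 2^p per restart while the measure shrinks by
s / (1 - s) <= s / (1 - t), which is where 2^r s / (1 - t) < 1 is used. The
outcome is that the integral of |g - c_Q0|^p over Q0 is bounded by that of any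
function dominating (inf_Q M_r f)^p on every subcube Q ([local_oscillation]).
Going from the constants back to g needs a weak density theorem along dyadic
boxes ([Rn_dyadic_density]).

It remains to integrate (M_r f)^p over Q0, with h = |f|^r and q = p / r <= 1.
If y is a point of Q0 and lam bounds the averages of h over the cubes that
contain y, then on Q0 the maximal function of h is controlled by lam and by the
dyadic maximal functions of h on 2^n large boxes ([average_le_pathmax], the
one-third trick). A Bellman function argument integrates those: to the power
q < 1 the integral is at most lam^q / (1 - q) times the volume
([dyadic_maximal_pow]), and taking lam close to inf_Q0 (M_r f)^r gives the bound
by c_p inf_Q0 M_r f. For q = 1 the integral is bounded by that of h log (h / lam)
([dyadic_maximal_entropy]), which the Luxemburg norms of f control. All suprema
over cubes follow from these estimates on one cube. *)

Set Implicit Arguments.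
Unset Strict Implicit.
Unset Printing Implicit Defensive.

Import Order.TTheory GRing.Theory Num.Theory.
Import numFieldNormedType.Exports.

Local Open Scope classical_set_scope.
Local Open Scope ring_scope.

(** * Dyadic boxes *)

(** The dyadic argument uses only the coordinate functions and the volumes of
    cubes, so it is stated for any measure space that has them; Lebesgue measure
    enters through [Rn_coordinates]. *)
Record coordinates (R : realType) (n : nat) d (E : measurableType d)
    (mu : {measure set E -> \bar R}) := Coordinates {
  crd : E -> n.-tuple R;
  measurable_crd : forall i, measurable_fun [set: E] (fun z => tnth (crd z) i);
  mu_crd_cube : forall (a : n.-tuple R) (l : R), 0 < l ->
    mu [set z | forall i, tnth a i <= tnth (crd z) i <= tnth a i + l]
    = (l ^+ n)%:E }.

Section boxes.
Context {R : realType} {n : nat} {d} {E : measurableType d}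
  {mu : {measure set E -> \bar R}} (K : coordinates n mu).
Notation pt := (n.-tuple R).
Notation dir := {ffun 'I_n -> bool}.

Definition cbox (a : pt) (l : R) : set E :=
  [set z | forall i, tnth a i <= tnth (crd K z) i <= tnth a i + l].

(** Half-open boxes are the exact disjoint unions of their children, which closed
    cubes are only up to null sets. *)
Definition box (a : pt) (l : R) : set E :=
  [set z | forall i, tnth a i <= tnth (crd K z) i < tnth a i + l].

Definition childv (a : pt) (l : R) (v : dir) : pt :=
  [tuple if v i then tnth a i + l / 2 else tnth a i | i < n].

Definition side (a : pt) (l : R) (z : E) : dir :=
  [ffun i => tnth a i + l / 2 <= tnth (crd K z) i].

Definition sub (a : pt) (l : R) (z : E) : pt := childv a l (side a l z).

Fixpoint desc N (a : pt) (l : R) (z : E) : pt :=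
  if N is N'.+1 then desc N' (sub a l z) (l / 2) z else a.

Lemma box_child a l v : 0 < l -> box (childv a l v) (l / 2) `<=` box a l.
Proof.
move=> l0 z zv i; have := zv i; rewrite tnth_mktuple; case: ifP => _; lra.
Qed.

Lemma side_child a l v z : 0 < l -> box (childv a l v) (l / 2) z ->
  side a l z = v.
Proof.
move=> l0 zv; apply/ffunP => i; rewrite ffunE; have := zv i.
rewrite tnth_mktuple; case: (v i) => /andP[h1 h2]; first exact/idP.
by apply/negbTE; rewrite -ltNge; lra.
Qed.

Lemma sub_child a l v z : 0 < l -> box (childv a l v) (l / 2) z ->
  sub a l z = childv a l v.
Proof. by move=> l0 zv; rewrite /sub (side_child l0 zv). Qed.

Lemma in_sub a l z : box a l z -> box (sub a l z) (l / 2) z.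
Proof.
move=> za i; have := za i; rewrite tnth_mktuple ffunE; case: ifPn; lra.
Qed.

Lemma in_desc N a l z : box a l z -> box (desc N a l z) (l / 2 ^+ N) z.
Proof.
elim: N a l => [|N IH] a l za /=; first by rewrite expr0 divr1.
have := IH _ _ (in_sub za).
by rewrite exprS invfM mulrA.
Qed.

Lemma box_childrenE a l : 0 < l ->
  box a l = \big[setU/set0]_(v : dir) box (childv a l v) (l / 2).
Proof.
move=> l0; rewrite -bigcup_seq; apply/seteqP; split => [z za|z [v _]].
  by exists (side a l z) => /=; [rewrite mem_index_enum|exact: in_sub].
exact: box_child.
Qed.

Lemma trivIset_children (A : set dir) a l : 0 < l ->
  trivIset A (fun v => box (childv a l v) (l / 2)).
Proof.
move=> l0 v w _ _ [z [zv zw]].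
by rewrite -(side_child l0 zv) -(side_child l0 zw).
Qed.

Lemma box_cbox a l : box a l `<=` cbox a l.
Proof. by move=> z za i; have /andP[-> /ltW] := za i. Qed.

Lemma cbox_child a l v : 0 < l -> cbox (childv a l v) (l / 2) `<=` cbox a l.
Proof.
move=> l0 z zv i; have := zv i; rewrite tnth_mktuple; case: ifP => _; lra.
Qed.

Lemma measurable_crd_itv (I : 'I_n -> interval R) :
  measurable [set z | forall i, tnth (crd K z) i \in I i].
Proof.
rewrite (_ : [set _ | _] = \big[setI/setT]_(i < n)
    ((fun z => tnth (crd K z) i) @^-1` [set` I i])).
  apply: bigsetI_measurable => i _; rewrite -[X in measurable X]setTI.
  exact: measurable_crd.
apply/seteqP; split => t.
  by move=> h; rewrite -bigcap_seq => i _ /=; exact: h.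
rewrite -bigcap_seq => h i.
exact: h i (mem_index_enum i).
Qed.

Lemma measurable_box a l : measurable (box a l).
Proof.
rewrite (_ : box a l = [set z | forall i,
    tnth (crd K z) i \in `[tnth a i, tnth a i + l[]).
  exact: (measurable_crd_itv (fun i => `[tnth a i, tnth a i + l[)).
by apply/seteqP; split => z h i; have := h i; rewrite /= in_itv.
Qed.

Lemma measurable_cbox a l : measurable (cbox a l).
Proof.
rewrite (_ : cbox a l = [set z | forall i,
    tnth (crd K z) i \in `[tnth a i, tnth a i + l]]).
  exact: (measurable_crd_itv (fun i => `[tnth a i, tnth a i + l])).
by apply/seteqP; split => z h i; have := h i; rewrite /= in_itv.
Qed.

Lemma mu_cbox a l : 0 < l -> mu (cbox a l) = (l ^+ n)%:E.
Proof. exact: mu_crd_cube. Qed.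

(** The box contains the closed cubes with the same corner and side l x, for all
    x < 1. *)
Lemma mu_box a l : 0 < l -> mu (box a l) = (l ^+ n)%:E.
Proof.
move=> l0; apply/eqP; rewrite eq_le; apply/andP; split.
  rewrite -(mu_cbox a l0); apply: le_measure; rewrite ?inE.
  - exact: measurable_box.
  - exact: measurable_cbox.
  - exact: box_cbox.
have sub_x (x : R) : 0 < x < 1 -> (((l * x) ^+ n)%:E <= mu (box a l))%E.
  move=> /andP[x0 x1]; rewrite -(mu_cbox a); last by rewrite mulr_gt0.
  apply: le_measure; rewrite ?inE.
  - exact: measurable_cbox.
  - exact: measurable_box.
  - move=> z za i; have /andP[-> h] := za i; rewrite /= (le_lt_trans h)// ltrD2l.
    by rewrite gtr_pMr.
rewrite leNgt; apply/negP => lt_mu.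
have mu_fin : mu (box a l) \is a fin_num.
  by rewrite ge0_fin_numE// (lt_trans lt_mu) ?ltry.
move: lt_mu sub_x; rewrite -(fineK mu_fin) lte_fin => lt_mu sub_x.
have cvg1 : (l * x) ^+ n @[x --> (1 : R)^'-] --> (l * 1) ^+ n.
  apply: cvg_at_left_filter.
  apply: (@continuous_comp _ _ _ (fun x : R => l * x) (fun x : R => x ^+ n)).
    exact: mulrl_continuous.
  exact: exprn_continuous.
rewrite -[in X in _ < X](mulr1 l) in lt_mu.
near (1 : R)^'- => x.
have : fine (mu (box a l)) < (l * x) ^+ n.
  by near: x; exact: (cvgr_gt _ cvg1).
rewrite ltNge -lee_fin sub_x//; apply/andP; split => //.
Unshelve. all: by end_near. Qed.

Lemma ge0_integral_children a l (f : E -> \bar R) : 0 < l ->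
  measurable_fun (box a l) f -> (forall z, box a l z -> 0 <= f z)%E ->
  (\int[mu]_(z in box a l) f z =
    \sum_(v : dir) \int[mu]_(z in box (childv a l v) (l / 2)) f z)%E.
Proof.
move=> l0 mf f0; rewrite box_childrenE// ge0_integral_bigsetU//.
- by move=> v; exact: measurable_box.
- exact: index_enum_uniq.
- exact: trivIset_children.
- by rewrite -box_childrenE.
- by rewrite -box_childrenE.
Qed.

Lemma measure_children a l (X : set E) : 0 < l -> measurable X ->
  (mu (X `&` box a l) = \sum_(v : dir) mu (X `&` box (childv a l v) (l / 2)))%E.
Proof.
move=> l0 mX; rewrite -integral_indic//; last exact: measurable_box.
rewrite ge0_integral_children//.
- by apply: eq_bigr => v _; rewrite integral_indic//; exact: measurable_box.
- by apply/measurable_EFinP; apply: measurable_funTS; exact: measurable_indic.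
Qed.

Lemma card_dir : #|dir| = (2 ^ n)%N.
Proof. by rewrite card_ffun card_bool card_ord. Qed.

Lemma sum_children_vol (l : R) : \sum_(v : dir) (l / 2) ^+ n = l ^+ n.
Proof.
rewrite sumr_const card_dir -(mulr_natl _ (2 ^ n)) natrX -exprMn.
by rewrite mulrC divfK.
Qed.

Lemma measurable_side_eq a l v : measurable [set z : E | side a l z = v].
Proof.
rewrite (_ : [set _ | _] = \big[setI/setT]_(i < n)
    ((fun z : E => tnth (crd K z) i) @^-1`
      [set x : R | (tnth a i + l / 2 <= x) = v i])).
  apply: bigsetI_measurable => i _; rewrite -[X in measurable X]setTI.
  apply: measurable_crd => //.
  case: (v i).
    rewrite (_ : [set _ | _] = `[tnth a i + l / 2, +oo[%classic)//.
    by apply/seteqP; split => x /=; rewrite in_itv/= andbT.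
  rewrite (_ : [set _ | _] = `]-oo, tnth a i + l / 2[%classic)//.
  by apply/seteqP; split => x /=; rewrite in_itv/= ltNge => h; [exact/negbT|exact/negbTE].
rewrite -bigcap_seq; apply/seteqP; split => z /=.
  by move=> <- i _ /=; rewrite ffunE.
by move=> h; apply/ffunP => i; rewrite ffunE; apply: h; rewrite /= mem_index_enum.
Qed.

Lemma measurable_fun_side d' (U : measurableType d') a l (f : dir -> E -> U) :
  (forall v, measurable_fun [set: E] (f v)) ->
  measurable_fun [set: E] (fun z => f (side a l z) z).
Proof.
move=> mf _ Y mY; rewrite setTI.
rewrite (_ : _ @^-1` _ = \big[setU/set0]_(v : dir)
    ([set z | side a l z = v] `&` (f v @^-1` Y))).
  apply: bigsetU_measurable => v _; apply: measurableI.
    exact: measurable_side_eq.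
  by rewrite -[X in measurable X]setTI; exact: mf.
rewrite -bigcup_seq; apply/seteqP; split => z /=.
  by move=> h; exists (side a l z) => //=; rewrite mem_index_enum.
by move=> [v _ [<-]].
Qed.

(** Keeping the running maximum in the argument y makes both the stopping argument
    and the Bellman argument plain inductions on N. *)
Fixpoint pathmax (F : pt -> R -> R) N (y : R) a l (z : E) : R :=
  let y' := Num.max y (F a l) in
  if N is N'.+1 then pathmax F N' y' (sub a l z) (l / 2) z else y'.

Lemma measurable_pathmax F N y a l : measurable_fun [set: E] (pathmax F N y a l).
Proof.
elim: N y a l => [|N IH] y a l /=; first exact: measurable_cst.
exact: (@measurable_fun_side _ _ a l (fun v =>
  pathmax F N (Num.max y (F a l)) (childv a l v) (l / 2))).
Qed.

Lemma measurable_fun_desc d' (U : measurableType d') (F : pt -> U) N a l :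
  measurable_fun [set: E] (fun z => F (desc N a l z)).
Proof.
elim: N a l => [|N IH] a l /=; first exact: measurable_cst.
exact: (@measurable_fun_side _ _ a l
  (fun v z => F (desc N (childv a l v) (l / 2) z))).
Qed.

Lemma pathmax_ge F N y a l z : y <= pathmax F N y a l z.
Proof.
elim: N y a l => [|N IH] y a l /=; first by rewrite le_max lexx.
by apply: le_trans (IH _ _ _); rewrite le_max lexx.
Qed.

Lemma pathmax_desc F N k y a l z : (k <= N)%N ->
  F (desc k a l z) (l / 2 ^+ k) <= pathmax F N y a l z.
Proof.
elim: N y a l k => [|N IH] y a l [|k] //= kN.
- by rewrite expr0 divr1 le_max lexx orbT.
- by rewrite expr0 divr1 (le_trans _ (pathmax_ge _ _ _ _ _ _))// le_max lexx orbT.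
- by rewrite exprS invfM mulrA; exact: IH.
Qed.

Lemma pathmax_homo F y a l z : {homo (fun N => pathmax F N y a l z) : N M / (N <= M)%N >-> N <= M}.
Proof.
move=> N M; elim: N M y a l => [|N IH] [|M] y a l //= NM; last exact: IH.
exact: pathmax_ge.
Qed.

Lemma pathmax_le F F' k N y y' a l z :
  (forall a l, F a l <= F' a l + k) -> y <= y' + k ->
  pathmax F N y a l z <= pathmax F' N y' a l z + k.
Proof.
move=> FF'; have step x x' b m : x <= x' + k ->
    Num.max x (F b m) <= Num.max x' (F' b m) + k.
  move=> xx'; rewrite ge_max; apply/andP; split.
    by apply: le_trans xx' _; rewrite lerD2r le_max lexx.
  by apply: le_trans (FF' _ _) _; rewrite lerD2r le_max lexx orbT.
elim: N y y' a l => [|N IH] y y' a l yy' /=; first exact: step.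
by apply: IH; exact: step.
Qed.

(** The part of the density theorem that is needed: the set of points around
    which X is sparse in every dyadic box is null. *)
Definition dyadic_density := forall a l (X : set E) (s : R),
  0 < l -> 0 < s < 1 -> measurable X -> X `<=` box a l ->
  (forall z N, X z -> (mu (X `&` box (desc N a l z) (l / 2 ^+ N)) <=
    (s * (l / 2 ^+ N) ^+ n)%:E)%E) ->
  mu X = 0.

End boxes.

(** * Dyadic approximation and density *)

Section dyadic_approximation.
Context {R : realType} {n : nat} {d} {E : measurableType d}
  {mu : {measure set E -> \bar R}} (K : coordinates n mu).
Notation pt := (n.-tuple R).
Notation box := (box K).
Notation desc := (desc K).

(** Finite unions of dyadic boxes, encoded by the subdivision trees that exhibit
    them. Complements and unions are then built by induction on the tree, and no
    common generation has to be chosen. *)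
Inductive dyadic_union : pt -> R -> set E -> Prop :=
| dyadic_union_full a l D : box a l `<=` D -> dyadic_union a l D
| dyadic_union_empty a l D : box a l `<=` ~` D -> dyadic_union a l D
| dyadic_union_node a l D : (forall v, dyadic_union (childv a l v) (l / 2) D) -> dyadic_union a l D.

Lemma dyadic_union_child a l D v : 0 < l -> dyadic_union a l D ->
  dyadic_union (childv a l v) (l / 2) D.
Proof.
move=> l0 H; case: H v l0 => {a l D} [a l D sub|a l D sub|a l D ch] v l0.
- by apply: dyadic_union_full; apply: subset_trans sub; exact: box_child.
- by apply: dyadic_union_empty; apply: subset_trans sub; exact: box_child.
- exact: ch.
Qed.

Lemma dyadic_union_eq a l D D' : 0 < l -> dyadic_union a l D ->
  (forall z, box a l z -> D z <-> D' z) -> dyadic_union a l D'.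
Proof.
move=> l0 H; elim: H D' l0 => {a l D} [a l D sub|a l D sub|a l D ch IH] D' l0 DD'.
- by apply: dyadic_union_full => z za; apply/(DD' z za)/sub.
- by apply: dyadic_union_empty => z za /(DD' z za); exact: sub.
- apply: dyadic_union_node => v; apply: IH; first by rewrite divr_gt0.
  by move=> z zv; apply: DD'; exact: box_child zv.
Qed.

Lemma dyadic_unionC a l D : dyadic_union a l D -> dyadic_union a l (~` D).
Proof.
elim=> {a l D} [a l D sub|a l D sub|a l D ch IH].
- by apply: dyadic_union_empty; rewrite setCK.
- exact: dyadic_union_full.
- exact: dyadic_union_node.
Qed.

Lemma dyadic_unionU a l D1 D2 : 0 < l -> dyadic_union a l D1 -> dyadic_union a l D2 ->
  dyadic_union a l (D1 `|` D2).
Proof.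
move=> l0 H; elim: H l0 => {a l D1} [a l D1 sub|a l D1 sub|a l D1 ch IH] l0 H2.
- by apply: dyadic_union_full => z /sub; left.
- by apply: (dyadic_union_eq l0 H2) => z za; split=> [|[/(sub z za)//|//]]; right.
- apply: dyadic_union_node => v; apply: IH; first by rewrite divr_gt0.
  exact: dyadic_union_child.
Qed.

Lemma setI_box_children a l (D : set E) : 0 < l ->
  D `&` box a l =
  \big[setU/set0]_(v : {ffun 'I_n -> bool}) (D `&` box (childv a l v) (l / 2)).
Proof. by move=> l0; rewrite box_childrenE// big_distrr. Qed.

Lemma measurable_dyadic_union a l D : 0 < l -> dyadic_union a l D -> measurable (D `&` box a l).
Proof.
move=> l0 H; elim: H l0 => {a l D} [a l D sub|a l D sub|a l D ch IH] l0.
- by rewrite setIidr//; exact: measurable_box.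
- by rewrite (_ : _ `&` _ = set0)//; apply/seteqP; split => z // [Dz /sub].
- rewrite setI_box_children//; apply: bigsetU_measurable => v _.
  by apply: IH; rewrite divr_gt0.
Qed.

(** A leaf box that meets X contains a point of X, so its density bound applies;
    a leaf box that does not meet X contributes nothing. *)
Lemma dyadic_union_density (X : set E) (s : R) a l D : measurable X -> 0 <= s -> 0 < l ->
  (forall N z, X z -> box a l z ->
    (mu (X `&` box (desc N a l z) (l / 2 ^+ N)) <= (s * (l / 2 ^+ N) ^+ n)%:E)%E) ->
  dyadic_union a l D ->
  (mu (X `&` (D `&` box a l)) <= s%:E * mu (D `&` box a l))%E.
Proof.
move=> mX s0 l0 hX H; elim: H l0 hX =>
  {a l D} [a l D sub|a l D sub|a l D ch IH] l0 hX.
- rewrite (setIidr sub) mu_box// -EFinM.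
  have [->|/set0P[z [Xz za]]] := eqVneq (X `&` box a l) set0.
    by rewrite measure0 lee_fin mulr_ge0 ?exprn_ge0// ltW.
  by have := hX 0%N z Xz za; rewrite expr0 divr1.
- rewrite (_ : D `&` box a l = set0) ?setI0 ?measure0 ?mule0//.
  by apply/seteqP; split => z // [Dz /sub].
have l20 : 0 < l / 2 by rewrite divr_gt0.
have mD v : measurable (D `&` box (childv a l v) (l / 2)).
  exact: measurable_dyadic_union (ch v).
have mDa : measurable (D `&` box a l) by exact: measurable_dyadic_union (dyadic_union_node ch).
have split_mu (Y : set E) : measurable Y ->
    (mu (Y `&` (D `&` box a l)) =
    \sum_(v : {ffun 'I_n -> bool}) mu (Y `&` (D `&` box (childv a l v) (l / 2))))%E.
  move=> mY.
  have -> : Y `&` (D `&` box a l) = Y `&` (D `&` box a l) `&` box a l.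
    by rewrite -!setIA setIid.
  rewrite measure_children//; last exact: measurableI.
  apply: eq_bigr => v _; congr (mu _); apply/seteqP; split => z [].
    by move=> [Yz [Dz _]] zv.
  by move=> Yz [Dz zv]; do !split => //; exact: box_child zv.
rewrite (split_mu X mX) -(setTI (D `&` box a l)) (split_mu setT measurableT).
rewrite ge0_sume_distrr//; apply: lee_sum => v _; rewrite setTI.
apply: IH => // N z Xz zv.
have := hX N.+1 z Xz (box_child l0 zv).
by rewrite /= (sub_child l0 zv) exprS invfM mulrA.
Qed.

Definition symdiff_in (a : pt) (l : R) (B D : set E) : set E :=
  (B `\` D `|` D `\` B) `&` box a l.

(** These sets form a sigma-algebra that contains the coordinate half-spaces. *)
Definition approximable (a : pt) (l : R) (B : set E) :=
  measurable (B `&` box a l) /\ forall eta : R, 0 < eta ->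
  exists D, dyadic_union a l D /\ (mu (symdiff_in a l B D) <= eta%:E)%E.

Lemma measurable_symdiff a l B D : 0 < l -> measurable (B `&` box a l) ->
  dyadic_union a l D -> measurable (symdiff_in a l B D).
Proof.
move=> l0 mB /(measurable_dyadic_union l0) mD.
rewrite (_ : symdiff_in _ _ _ _ = (B `&` box a l) `\` (D `&` box a l) `|`
  (D `&` box a l) `\` (B `&` box a l)).
  by apply: measurableU; exact: measurableD.
apply/seteqP; split => z.
  by move=> [[[Bz Dz]|[Dz Bz]] za]; [left|right]; split => // -[].
by move=> [[[Bz za] Dz]|[[Dz za] Bz]]; split => //; [left|right]; split => // ?;
  [apply: Dz|apply: Bz].
Qed.

Section sigma_algebra_of_approximable_sets.
Variables (a : pt) (l : R).
Hypothesis l0 : 0 < l.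

Lemma approximable_dyadic_union D : dyadic_union a l D -> approximable a l D.
Proof.
move=> satD; split; first exact: measurable_dyadic_union.
move=> eta eta0; exists D; split => //.
by rewrite /symdiff_in setDv setU0 set0I measure0 lee_fin ltW.
Qed.

Lemma approximable_setC B : approximable a l B -> approximable a l (~` B).
Proof.
move=> [mB apB]; split.
  rewrite (_ : _ `&` _ = box a l `\` (B `&` box a l)).
    by apply: measurableD => //; exact: measurable_box.
  apply/seteqP; split => z [] // => [Bz za|za Bz]; split => //; first by case.
  by move=> Bz'; apply: Bz.
move=> eta /apB[D [satD muD]]; exists (~` D); split; first exact: dyadic_unionC.
rewrite (_ : symdiff_in _ _ _ _ = symdiff_in a l B D)//.
by rewrite /symdiff_in !setDE !setCK setUC (setIC (~` B)) (setIC (~` D)).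
Qed.

Lemma approximable_setU B1 B2 : approximable a l B1 -> approximable a l B2 ->
  approximable a l (B1 `|` B2).
Proof.
move=> [mB1 ap1] [mB2 ap2]; split; first by rewrite setIUl; exact: measurableU.
move=> eta eta0; have eta2 : 0 < eta / 2 by rewrite divr_gt0.
have [D1 [satD1 mu1]] := ap1 _ eta2; have [D2 [satD2 mu2]] := ap2 _ eta2.
exists (D1 `|` D2); split; first exact: dyadic_unionU.
have m1 := measurable_symdiff l0 mB1 satD1.
have m2 := measurable_symdiff l0 mB2 satD2.
rewrite [eta]splitr EFinD; apply: le_trans (leeD mu1 mu2).
apply: le_trans (measureU2 mu m1 m2); apply: le_measure; rewrite ?inE.
- apply: measurable_symdiff => //; last exact: dyadic_unionU.
  by rewrite setIUl; exact: measurableU.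
- exact: measurableU.
move=> z [[[[B1z|B2z] nD]|[[D1z|D2z] nB]] za].
- by left; split => //; left; split => // ?; apply: nD; left.
- by right; split => //; left; split => // ?; apply: nD; right.
- by left; split => //; right; split => // ?; apply: nB; left.
- by right; split => //; right; split => // ?; apply: nB; right.
Qed.

(** In a box of finite measure, a finite subunion already exhausts the union up to
    half of the tolerance. *)
Lemma approximable_bigcup (B : (set E)^nat) : (forall k, approximable a l (B k)) ->
  approximable a l (\bigcup_k B k).
Proof.
move=> apB; have mB : measurable (\bigcup_k B k `&` box a l).
  by rewrite setI_bigcupl; apply: bigcupT_measurable => k; have [] := apB k.
split => // eta eta0; have eta2 : 0 < eta / 2 by rewrite divr_gt0.
pose U N := \big[setU/set0]_(k < N) B k.
have apU N : approximable a l (U N).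
  rewrite /U; elim: N => [|N IH]; last by rewrite big_ord_recr; exact: approximable_setU.
  by rewrite big_ord0; apply: approximable_dyadic_union; apply: dyadic_union_empty; rewrite setC0.
pose F N := (\bigcup_k B k `&` box a l) `\` (U N `&` box a l).
have mF N : measurable (F N) by apply: measurableD => //; have [] := apU N.
have F0 : \bigcap_N F N = set0.
  apply/seteqP; split => z // Fz.
  have [[k _ Bkz] za] : (\bigcup_k B k `&` box a l) z by have [] := Fz 0%N I.
  have [_ +] := Fz k.+1 I; apply; split => //.
  by rewrite /U -bigcup_mkord; exists k => /=.
have F_cvg : mu (F N) @[N --> \oo] --> 0%E.
  rewrite -(measure0 mu) -F0; apply: nonincreasing_cvg_mu => //.
  - apply: (@le_lt_trans _ _ (mu (box a l))); last by rewrite mu_box ?ltry.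
    by apply: le_measure; rewrite ?inE//; [exact: measurable_box|move=> z [[]]].
  - by rewrite F0.
  - move=> N M NM; apply/subsetPset; apply: setDS; apply: setSI.
    exact: subset_bigsetU.
have [N _ /(_ N (leqnn N)) FN] : \forall N \near \oo, (mu (F N) < (eta / 2)%:E)%E.
  apply: (F_cvg [set u | (u < (eta / 2)%:E)%E]).
  by apply: open_ereal_lt'; rewrite lte_fin.
have [mUN apUN] := apU N; have [D [satD muD]] := apUN _ eta2.
exists D; split => //; have mD := measurable_symdiff l0 mUN satD.
rewrite [eta]splitr EFinD; apply: le_trans (leeD (ltW FN) muD).
apply: le_trans (measureU2 mu (mF N) mD); apply: le_measure; rewrite ?inE.
- exact: measurable_symdiff.
- exact: measurableU.
have UB : U N `<=` \bigcup_k B k by exact: bigsetU_bigcup.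
move=> z [[[Bz nD]|[Dz nB]] za].
- have [Uz|nU] := pselect (U N z); first by right; split => //; left.
  by left; split => // -[].
- by right; split => //; right; split => // /UB.
Qed.

Lemma approximable_eq B B' : (forall z, box a l z -> B z <-> B' z) ->
  approximable a l B -> approximable a l B'.
Proof.
move=> BB'; suff -> : approximable a l B = approximable a l B' by [].
have E1 : B `&` box a l = B' `&` box a l.
  by apply/seteqP; split => z [Bz za]; split => //; apply/BB'.
rewrite /approximable E1; congr (_ /\ _); apply: eq_forall => eta.
congr (_ -> _); apply: eq_exists => D; congr (_ /\ is_true (mu _ <= _)%E).
by apply/seteqP; split => z [[[? h]|[? h]] za]; split => //;
  [left|right|left|right]; split => //; try (by apply/BB'); move/BB': h => h /h; apply.
Qed.

(** A half-space is the union over N of the boxes of generation N that it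
    contains. *)
Lemma approximable_halfspace i (x : R) :
  approximable a l [set z | tnth (crd K z) i < x].
Proof.
set H := [set z | _].
pose D N b m := [set z | box (desc N b m z) (m / 2 ^+ N) `<=` H].
have satD N : forall b m, 0 < m -> dyadic_union b m (D N b m).
  elim: N => [|N IH] b m m0.
    rewrite /D /= expr0 divr1; have [sub|nsub] := pselect (box b m `<=` H).
      by apply: dyadic_union_full.
    by apply: dyadic_union_empty => z _.
  apply: dyadic_union_node => v; have m20 : 0 < m / 2 by rewrite divr_gt0.
  apply: (dyadic_union_eq m20 (IH (childv b m v) _ m20)) => z zv.
  by rewrite /D /= (sub_child m0 zv) exprS invfM mulrA.
apply: (@approximable_eq (\bigcup_N D N a l)); last first.
  by apply: approximable_bigcup => N; apply: approximable_dyadic_union; exact: satD.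
move=> z za; split => [[N _]|zx]; first by apply; exact: in_desc.
rewrite /H /= in zx; have xz : 0 < x - tnth (crd K z) i by rewrite subr_gt0.
exists (Num.bound (l / (x - tnth (crd K z) i))) => //.
set N := Num.bound _ => w wd.
have dN : l / 2 ^+ N <= x - tnth (crd K z) i.
  rewrite ler_pdivrMr ?exprn_gt0// mulrC -ler_pdivrMr//.
  apply: (@le_trans _ _ N%:R); first by rewrite ltW// archi_boundP// divr_ge0 ?ltW.
  by rewrite -natrX ler_nat ltnW// ltn_expl.
have := wd i; have := in_desc N za i; rewrite /H /=; lra.
Qed.

Definition halfspaces : set (set E) :=
  [set B | exists i x, B = [set z | tnth (crd K z) i < x]].

Lemma approximable_sigma : <<s halfspaces >> `<=` approximable a l.
Proof.
apply: smallest_sub => [|_ [i [x ->]]]; last exact: approximable_halfspace.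
split; first by apply: approximable_dyadic_union; apply: dyadic_union_empty; rewrite setC0.
  by move=> B; rewrite setTD; exact: approximable_setC.
exact: approximable_bigcup.
Qed.

End sigma_algebra_of_approximable_sets.

(** If X has density at most s around its points, then so does it in every finite
    dyadic union. Approximating a tight outer cover of X by such unions gives
    mu X <= s mu X. *)
Lemma dyadic_densityP :
  (forall X (eta : R), measurable X -> 0 < eta -> (mu X < +oo)%E ->
    exists2 B, <<s halfspaces >> B & X `<=` B /\ (mu B <= mu X + eta%:E)%E) ->
  dyadic_density K.
Proof.
move=> outer a l X s l0 /andP[s0 s1] mX Xa hX.
have muX : (mu X < +oo)%E.
  apply: (@le_lt_trans _ _ (mu (box a l))); last by rewrite mu_box ?ltry.
  by apply: le_measure; rewrite ?inE//; exact: measurable_box.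
have fX : mu X \is a fin_num by rewrite ge0_fin_numE.
suff key (eta : R) : 0 < eta -> fine (mu X) <= s * fine (mu X) + 3 * eta.
  apply/eqP; rewrite eq_le measure_ge0 andbT -(fineK fX) lee_fin leNgt.
  apply/negP => x0; have e0 : 0 < (1 - s) * fine (mu X) / 4.
    by rewrite divr_gt0// mulr_gt0// subr_gt0.
  by have := key _ e0; have : 0 < (1 - s) * fine (mu X); [rewrite mulr_gt0// subr_gt0|lra].
move=> eta0; have [B sB [XB muB]] := outer X eta mX eta0 muX.
have [mB apB] := @approximable_sigma a l l0 B sB; have [D [satD muD]] := apB _ eta0.
have mD := measurable_dyadic_union l0 satD.
have mS := measurable_symdiff l0 mB satD.
have h1 : (mu X <= mu (X `&` (D `&` box a l)) + eta%:E)%E.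
  apply: le_trans (leeD2l _ muD).
  apply: le_trans (measureU2 mu (measurableI _ _ mX mD) mS).
  apply: le_measure; rewrite ?inE//; first by apply: measurableU => //; exact: measurableI.
  move=> z Xz; have [Dz|nDz] := pselect (D z).
    by left; split => //; split => //; exact: Xa.
  by right; split; [left; split => //; exact: XB|exact: Xa].
have h2 : (mu (D `&` box a l) <= mu X + eta%:E + eta%:E)%E.
  apply: (@le_trans _ _ (mu (B `&` box a l) + mu (symdiff_in a l B D))%E).
    apply: le_trans (measureU2 mu mB mS).
    apply: le_measure; rewrite ?inE//; first exact: measurableU.
    move=> z [Dz za]; have [Bz|nBz] := pselect (B z); first by left.
    by right; split => //; right.
  apply: leeD => //; apply: le_trans muB; apply: le_measure; rewrite ?inE//.
  suff sM : <<s halfspaces >> `<=` measurable by exact: sM.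
  apply: smallest_sub => [|_ [i [x ->]]]; first exact: sigma_algebra_measurable.
  rewrite (_ : [set _ | _] = (fun z => tnth (crd K z) i) @^-1` `]-oo, x[%classic).
    by rewrite -[X in measurable X]setTI; exact: measurable_crd.
  by apply/seteqP; split => z /=; rewrite in_itv.
have h3 := dyadic_union_density mX (ltW s0) l0 (fun N z Xz _ => hX z N Xz) satD.
have fD : mu (D `&` box a l) \is a fin_num.
  rewrite ge0_fin_numE// (le_lt_trans h2)// -(fineK fX) -!EFinD ltry//.
have f1 : mu (X `&` (D `&` box a l)) \is a fin_num.
  by rewrite ge0_fin_numE// (le_lt_trans h3)// -(fineK fD) -EFinM ltry.
move: h1 h2 h3; rewrite -(fineK fX) -(fineK fD) -(fineK f1) -!EFinD -EFinM !lee_fin.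
move=> h1 h2 h3.
have se : s * eta <= eta by rewrite ler_piMl// ltW.
by have := ler_wpM2l (ltW s0) h2; lra.
Qed.

End dyadic_approximation.

Section euclidean.
Context (R : realType) (n : nat).
Notation E := (Rn R n).
Notation mu := (@lebesgue R n).

Lemma measurable_Rn_coordinate (i : 'I_n) :
  measurable_fun [set: E] (fun z : E => tnth (z : n.-tuple R) i).
Proof.
move=> _ Y mY; apply: caratheodory_measurable_mu_ext.
exact: (measurable_tnth i measurableT mY).
Qed.

Lemma lebesgue_cube_coordinates (a : n.-tuple R) (l : R) : 0 < l ->
  mu [set z : E | forall i, tnth a i <= tnth (z : n.-tuple R) i <= tnth a i + l]
  = (l ^+ n)%:E.
Proof. by move=> /ltW /(lebesgue_cube a) []. Qed.

Definition Rn_coordinates : @coordinates R n _ E mu :=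
  Coordinates (crd := fun z : E => (z : n.-tuple R))
    measurable_Rn_coordinate lebesgue_cube_coordinates.

(** The Borel sets of n-tuples are generated by preimages under coordinates, and
    those of the line by the rays ]-oo, x[. *)
Lemma borel_halfspaces (B : set (n.-tuple (measurableTypeR R))) :
  measurable B -> <<s halfspaces Rn_coordinates >> (B : set E).
Proof.
have sS : sigma_algebra [set: E] <<s halfspaces Rn_coordinates >>.
  exact: smallest_sigma_algebra.
have [S0 SC SU] := sS.
suff : @measurable _ (n.-tuple (measurableTypeR R)) `<=`
    (<<s halfspaces Rn_coordinates >> : set (set (n.-tuple R))) by apply.
apply: smallest_sub => // A; rewrite -bigcup_seq => -[i _ [Y mY <-]].
rewrite setTI; move: Y mY.
have /= -> := RGenInftyO.measurableE R.
apply: smallest_sub => [|_ [x ->]].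
  split.
  - by rewrite /= preimage_set0.
  - by move=> A' /= SA'; have := SC _ SA'; rewrite !setTD preimage_setC.
  - by move=> F /= SF; rewrite preimage_bigcup; exact: SU.
apply: sub_sigma_algebra; exists i, x.
by apply/seteqP; split => z /=; rewrite in_itv.
Qed.

(** The tight outer covers come from the definition of the outer measure by Borel
    covers. *)
Lemma Rn_dyadic_density : dyadic_density Rn_coordinates.
Proof.
apply: dyadic_densityP => X eta mX eta0 Xoo.
have fX : mu X \is a fin_num by rewrite ge0_fin_numE.
have [_ [F [mF XF] <-] Flt] := lb_ereal_inf_adherent eta0 fX.
exists (\bigcup_k F k).
  by apply: borel_halfspaces; apply: bigcupT_measurable => k; exact: mF.
split => //; apply: le_trans (ltW Flt).
by apply: (@ereal_inf_lbound R); exists F => //; split.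
Qed.

End euclidean.

(** * Stopping cubes *)

Section powers.
Context {R : realType}.

Lemma le_powR (p x y : R) : 0 <= p -> 0 <= x -> x <= y -> x `^ p <= y `^ p.
Proof.
move=> p0 x0 xy; apply: ge0_ler_powR => //; rewrite nnegrE//.
exact: le_trans xy.
Qed.

Lemma powRD_le (p x y : R) : 0 <= p -> 0 <= x -> 0 <= y ->
  (x + y) `^ p <= 2 `^ p * (x `^ p + y `^ p).
Proof.
move=> p0; wlog xy : x y / x <= y => [wl x0 y0|x0 y0].
  have [|/ltW yx] := leP x y; first by move/wl; apply.
  by rewrite addrC (addrC (x `^ p)); exact: wl.
apply: (@le_trans _ _ ((2 * y) `^ p)); first by apply: le_powR => //; lra.
by rewrite powRM// ler_wpM2l ?powR_ge0// lerDr powR_ge0.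
Qed.

End powers.

Section stopping_cubes.
Context {R : realType} {n : nat} {d} {E : measurableType d}
  {mu : {measure set E -> \bar R}} (K : coordinates n mu) (n_gt0 : (0 < n)%N).
Notation pt := (n.-tuple R).
Notation dir := {ffun 'I_n -> bool}.
Notation box := (box K).
Notation cbox := (cbox K).
Notation pathmax := (pathmax K).

Variables (g : E -> R) (c osc : pt -> R -> R) (s : R) (top : set E).
Hypothesis mg : measurable_fun [set: E] g.
Hypotheses (s0 : 0 < s) (s3 : 3 * s < 1).

Definition deviation (x y : R) : set E := [set z | y < `|g z - x|].

Definition subcube (a : pt) (l : R) := 0 < l /\ cbox a l `<=` top.

Definition far (a : pt) (l : R) : set E :=
  cbox a l `&` deviation (c a l) (osc a l).

Hypothesis osc_gt0 : forall a l, subcube a l -> 0 < osc a l.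
Hypothesis osc_anti : forall a l a' l', subcube a l -> subcube a' l' ->
  cbox a l `<=` cbox a' l' -> osc a' l' <= osc a l.
Hypothesis osc_le : forall a l, subcube a l ->
  (mu (far a l) <= (s * l ^+ n)%:E)%E.

Lemma measurable_deviation (x y : R) : measurable (deviation x y).
Proof.
rewrite (_ : deviation x y = (fun z => `|g z - x|) @^-1` `]y, +oo[).
  rewrite -[X in measurable X]setTI.
  suff : measurable_fun [set: E] (fun z => `|g z - x|) by apply.
  by apply: measurableT_comp => //; exact: measurable_funB.
by apply/seteqP; split => z /=; rewrite in_itv/= andbT.
Qed.

Lemma measurable_far a l : measurable (far a l).
Proof.
by apply: measurableI; [exact: measurable_cbox|exact: measurable_deviation].
Qed.

Lemma subcube_child a l v : subcube a l -> subcube (childv a l v) (l / 2).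
Proof.
move=> [l0 atop]; split; first by rewrite divr_gt0.
by apply: subset_trans atop; exact: cbox_child.
Qed.

Lemma subcube_desc N a l z : subcube a l -> subcube (desc K N a l z) (l / 2 ^+ N).
Proof.
elim: N a l => [|N IH] a l Ha /=; first by rewrite expr0 divr1.
by rewrite exprS invfM mulrA; apply: IH; exact: subcube_child.
Qed.

(** The two exceptional sets have total measure at most 3 s l^n < l^n, so the
    smaller cube has a point at which g is close to both constants. *)
Lemma near_constants a l a' l' : subcube a l -> subcube a' l' ->
  cbox a l `<=` cbox a' l' -> l' ^+ n <= 2 * l ^+ n ->
  `|c a l - c a' l'| <= 2 * osc a l.
Proof.
move=> Ha Ha' aa' ll'; rewrite leNgt; apply/negP => cc.
have l0 := Ha.1; have ln0 : 0 < l ^+ n by rewrite exprn_gt0.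
have cover : cbox a l `<=` far a l `|` far a' l'.
  move=> z za.
  have [|h1] := ltP (osc a l) `|g z - c a l|; first by left.
  have [|h2] := ltP (osc a' l') `|g z - c a' l'|.
    by right; split => //; exact: aa'.
  exfalso; move: cc; apply/negP; rewrite -leNgt.
  have := osc_anti Ha Ha' aa'.
  have := ler_distD (g z) (c a l) (c a' l'); rewrite (distrC (c a l) (g z)); lra.
have : ((l ^+ n)%:E <= (s * l ^+ n)%:E + (s * l' ^+ n)%:E)%E.
  rewrite -(mu_cbox K a l0); apply: (le_trans (le_measure _ _ _ cover)).
  - by rewrite inE; exact: measurable_cbox.
  - by rewrite inE; apply: measurableU; exact: measurable_far.
  - apply: (le_trans (measureU2 _ (measurable_far _ _) (measurable_far _ _))).
    by apply: leeD; exact: osc_le.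
have := ler_wpM2l (ltW s0) ll'.
have : 3 * s * l ^+ n < 1 * l ^+ n by rewrite ltr_pM2r.
rewrite -EFinD lee_fin; lra.
Qed.

(** A parent has 2^n times the volume of its child, too much for [near_constants].
    The chain below joins them by cubes whose volumes double at each step; all of
    them share the corner of the parent that the child contains. *)
Definition chain_side (l : R) i := l / 2 * (2 `^ n%:R^-1) ^+ i.

Definition chain_corner (a : pt) l (v : dir) i : pt :=
  [tuple if v j then tnth a j + l - chain_side l i else tnth a j | j < n].

Lemma chain_sideS l i : chain_side l i.+1 ^+ n = 2 * chain_side l i ^+ n.
Proof.
rewrite /chain_side exprSr mulrA [LHS]exprMn [RHS]mulrC; congr (_ * _).
by rewrite -powR_mulrn ?powR_ge0// -powRrM mulVf ?powRr1 ?pnatr_eq0 ?gtn_eqF.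
Qed.

Lemma chain_side_gt0 l i : 0 < l -> 0 < chain_side l i.
Proof. by move=> l0; rewrite mulr_gt0 ?divr_gt0 ?exprn_gt0 ?powR_gt0. Qed.

Lemma chain_side_n l : chain_side l n = l.
Proof.
rewrite /chain_side -powR_mulrn ?powR_ge0// -powRrM mulVf ?powRr1 ?divfK//.
by rewrite pnatr_eq0 gtn_eqF.
Qed.

Lemma chain_sideW l i j : 0 < l -> (i <= j)%N -> chain_side l i <= chain_side l j.
Proof.
move=> l0 ij; rewrite ler_pM2l ?divr_gt0// ler_weXn2l//.
by rewrite -[leLHS](powRr0 2) ler_powR ?ler1n// invr_ge0 ler0n.
Qed.

Lemma chain_sub a l v i j : 0 < l -> (i <= j)%N ->
  cbox (chain_corner a l v i) (chain_side l i) `<=`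
  cbox (chain_corner a l v j) (chain_side l j).
Proof.
move=> l0 ij z zi k; have := zi k; rewrite !tnth_mktuple.
have := chain_sideW l0 ij; case: (v k); lra.
Qed.

Lemma chain_start a l v : chain_corner a l v 0 = childv a l v.
Proof.
apply: eq_from_tnth => j; rewrite !tnth_mktuple /chain_side expr0 mulr1.
by case: (v j) => //; field.
Qed.

Lemma chain_end a l v : chain_corner a l v n = a.
Proof.
apply: eq_from_tnth => j; rewrite !tnth_mktuple chain_side_n.
by case: (v j) => //; ring.
Qed.

Lemma child_constant a l v : subcube a l ->
  `|c (childv a l v) (l / 2) - c a l| <= (2 * n)%:R * osc (childv a l v) (l / 2).
Proof.
move=> Ha; have [l0 atop] := Ha.
have side0 : chain_side l 0 = l / 2 by rewrite /chain_side expr0 mulr1.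
have Hi i : (i <= n)%N -> subcube (chain_corner a l v i) (chain_side l i).
  move=> i_n; split; first exact: chain_side_gt0.
  apply: subset_trans atop; rewrite -[X in _ `<=` cbox X _](chain_end a l v).
  by rewrite -[X in _ `<=` cbox _ X]chain_side_n; exact: chain_sub.
pose P i := c (chain_corner a l v i) (chain_side l i).
have step i : (i <= n)%N ->
    `|P 0%N - P i| <= (2 * i)%:R * osc (childv a l v) (l / 2).
  elim: i => [|i IH] i_n; first by rewrite subrr normr0 muln0 mul0r.
  apply: (le_trans (ler_distD (P i) _ _)).
  rewrite mulnS addnC natrD mulrDl lerD ?IH ?(ltnW i_n)//.
  apply: le_trans (near_constants (Hi i (ltnW i_n)) (Hi _ i_n) _ _) _.
  - exact: chain_sub.
  - by rewrite chain_sideS.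
  - rewrite ler_pM2l// -(chain_start a l v) -side0; apply: osc_anti.
    + exact: Hi.
    + exact: Hi (ltnW i_n).
    + exact: chain_sub.
by have := step n (leqnn n); rewrite /P chain_start chain_end chain_side_n side0.
Qed.

(** On a box where the two constants are far apart, a point that is not
    exceptional for the smaller cube is exceptional for the larger one. *)
Lemma stopping_mass (E0 : set E) (a b : pt) (l m : R) : subcube a l ->
  E0 = deviation (c b m) (osc b m) ->
  osc a l + osc b m < `|c a l - c b m| ->
  (((1 - s) * l ^+ n)%:E <= mu (E0 `&` box a l))%E.
Proof.
move=> Ha -> stop; have l0 := Ha.1.
have mE0 : measurable (deviation (c b m) (osc b m) `&` box a l).
  by apply: measurableI; [exact: measurable_deviation|exact: measurable_box].
have cover : box a l `<=`
    far a l `|` (deviation (c b m) (osc b m) `&` box a l).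
  move=> z za.
  have [|h1] := ltP (osc a l) `|g z - c a l|.
    by left; split => //; exact: box_cbox.
  right; split => //; rewrite /deviation /=.
  have := ler_distD (g z) (c a l) (c b m).
  rewrite (distrC (c a l) (g z)); lra.
have : ((l ^+ n)%:E <= (s * l ^+ n)%:E +
    mu (deviation (c b m) (osc b m) `&` box a l))%E.
  rewrite -(mu_box K a l0); apply: (le_trans (le_measure _ _ _ cover)).
  - by rewrite inE; exact: measurable_box.
  - by rewrite inE; apply: measurableU => //; exact: measurable_far.
  - apply: (le_trans (measureU2 _ (measurable_far _ _) mE0)).
    by apply: leeD => //; exact: osc_le.
rewrite -leeBlDl// -EFinB mulrBl mul1r; exact: le_trans.
Qed.

Section recursion.
Variables (p : R) (I : pt -> R -> R).
Hypothesis p_gt0 : 0 < p.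
Hypothesis I_children : forall a l, subcube a l ->
  I a l = \sum_(v : dir) I (childv a l v) (l / 2).
Hypothesis I_ge : forall a l, subcube a l -> osc a l `^ p * l ^+ n <= I a l.

Let p0 : 0 <= p := ltW p_gt0.
Let theta := s / (1 - s).
Hypothesis theta_small : 2 `^ p * theta < 1.

Let kk : R := (2 * n)%:R + 2.
Let B := 2 `^ p / (1 - 2 `^ p * theta).
Let D := B * 2 `^ p * kk `^ p.
(** The excess over 4^p is the factor that turns the integral of Phi off the
    stopped boxes into the reserve D osc^p l^n of [own_bound]. *)
Definition recursion_constant := 2 `^ p * 2 `^ p + D / (1 - theta).
Let A := recursion_constant.

Let dev (x : R) (a : pt) (l : R) : R := `|c a l - x|.

Let J x N y b a l := (\int[mu]_(z in box a l) ((pathmax (dev x) N y a l z + b) `^ p)%:E)%E.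

(* own_bound measures the dyadic constants from that of the box itself. The term
   -D osc^p l^n is the reserve which pays for the next restart: there b grows by
   kk osc, and kk = 2 n + 2 bounds the jump of the constant at a stopped cube. *)
Let own_bound N := forall a l b, subcube a l -> 0 <= b ->
  (J (c a l) N 0 b a l <=
   (A * I a l + B * b `^ p * l ^+ n - D * osc a l `^ p * l ^+ n)%:E)%E.

(* relative_bound measures them from the constant of the last stopped cube above.
   The numbers u, X and Y are the volume of the stopped boxes and the integral of
   Phi off and on them; the integral of Phi off them rebuilds the reserve of the
   cube above, since it is at least osc^p times the volume which did not stop. *)
Let relative_bound N := forall (E0 : set E) a' l' a l y b, subcube a' l' -> subcube a l ->
  E0 = deviation (c a' l') (osc a' l') ->
  cbox a l `<=` cbox a' l' ->
  `|c a l - c a' l'| <= osc a l + osc a' l' ->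
  0 <= y <= 2 * osc a l -> 0 <= b ->
  exists u X Y : R, [/\ 0 <= u, X + Y = I a l,
    osc a' l' `^ p * (l ^+ n - u) <= X,
    (((1 - s) * u)%:E <= mu (E0 `&` box a l))%E &
    (J (c a' l') N y b a l <= (2 `^ p * 2 `^ p * X + 2 `^ p * b `^ p * l ^+ n
       + A * Y + B * 2 `^ p * b `^ p * u)%:E)%E].

Let two_ge1 : 1 <= 2 `^ p :> R.
Proof. by rewrite -[leLHS](powRr0 2) ler_powR// ler1n. Qed.

Let s_lt1 : s < 1. Proof. by move: s0 s3; lra. Qed.

Let theta_ge0 : 0 <= theta.
Proof. by rewrite divr_ge0 ?(ltW s0)// subr_ge0 ltW. Qed.

Let theta_lt1 : theta < 1.
Proof.
apply: le_lt_trans theta_small; rewrite ler_peMl//.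
Qed.

Let B_gt0 : 0 < B.
Proof. by rewrite divr_gt0 ?powR_gt0// subr_gt0. Qed.

Let D_ge0 : 0 <= D.
Proof. by rewrite /D mulr_ge0 ?powR_ge0// mulr_ge0 ?powR_ge0// ltW. Qed.

Lemma recursion_constant_ge0 : 0 <= recursion_constant.
Proof.
apply: addr_ge0; first by rewrite mulr_ge0 ?powR_ge0.
exact: divr_ge0 D_ge0 (ltW (etrans (subr_gt0 _ _) theta_lt1)).
Qed.

Let BE : 2 `^ p + B * 2 `^ p * theta = B.
Proof. by rewrite /B; field; rewrite gt_eqF// subr_gt0. Qed.

Let mJ x N y b a l : measurable_fun (box a l)
  (fun z => ((pathmax (dev x) N y a l z + b) `^ p)%:E).
Proof.
apply: measurable_funTS; apply/measurable_EFinP.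
apply: (measurableT_comp (measurable_powR p)).
by apply: measurable_funD => //; exact: measurable_pathmax.
Qed.

Let J_cst a l (x : R) : 0 < l ->
  (\int[mu]_(z in box a l) x%:E = (x * l ^+ n)%:E)%E.
Proof.
by move=> l0; rewrite integral_cst ?mu_box//; exact: measurable_box.
Qed.

Let J_children x N y b a l : 0 < l -> J x N.+1 y b a l =
  (\sum_(v : dir) J x N (Num.max y (dev x a l)) b (childv a l v) (l / 2))%E.
Proof.
move=> l0; rewrite /J (ge0_integral_children l0 (@mJ _ _ _ _ _ _)).
  apply: eq_bigr => v _; apply: eq_integral => z /[!inE] zv /=.
  by rewrite (sub_child l0 zv).
by move=> z _; rewrite lee_fin powR_ge0.
Qed.

Let relative_bound_leaf : relative_bound 0.
Proof.
move=> E0 a' l' a l y b Ha' Ha -> aa' near /andP[y0 y2] b0; have l0 := Ha.1.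
exists 0, (I a l), 0; split; rewrite ?addr0 ?mulr0 ?measure_ge0//.
  rewrite subr0; apply: le_trans (I_ge Ha); rewrite ler_wpM2r ?exprn_ge0 ?(ltW l0)//.
  by apply: le_powR => //; [exact: ltW (osc_gt0 Ha')|exact: osc_anti].
rewrite /J /= J_cst// lee_fin.
have o0 := osc_gt0 Ha; have oo := osc_anti Ha Ha' aa'.
apply: (@le_trans _ _ ((2 `^ p * (2 `^ p * osc a l `^ p + b `^ p)) * l ^+ n)).
  rewrite ler_wpM2r ?exprn_ge0 ?(ltW l0)// -powRM ?(ltW o0)//.
  apply: le_trans (powRD_le p0 _ b0); last by lra.
  apply: le_powR => //; first by rewrite addr_ge0// le_max y0.
  rewrite lerD2r ge_max y2 /dev; lra.
have := I_ge Ha; have := powR_ge0 2 p.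
set t := 2 `^ p => t0 ge; have := ler_wpM2l (mulr_ge0 t0 t0) ge; lra.
Qed.

Let relative_bound_step N : relative_bound N -> own_bound N -> relative_bound N.+1.
Proof.
move=> relN ownN E0 a' l' a l y b Ha' Ha E0E aa' near /andP[y0 y2] b0.
have l0 := Ha.1; have l20 : 0 < l / 2 by rewrite divr_gt0.
pose x := c a' l'; pose y' := Num.max y (dev x a l).
have o0 := osc_gt0 Ha; have oo := osc_anti Ha Ha' aa'.
have y'0 : 0 <= y' by rewrite le_max y0.
have y'2 : y' <= 2 * osc a l by rewrite ge_max y2 /dev /x; lra.
have child v : exists t : R * R * R, [/\ 0 <= t.1.1,
    t.1.2 + t.2 = I (childv a l v) (l / 2),
    osc a' l' `^ p * ((l / 2) ^+ n - t.1.1) <= t.1.2,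
    (((1 - s) * t.1.1)%:E <= mu (E0 `&` box (childv a l v) (l / 2)))%E &
    (J x N y' b (childv a l v) (l / 2) <=
     (2 `^ p * 2 `^ p * t.1.2 + 2 `^ p * b `^ p * (l / 2) ^+ n
       + A * t.2 + B * 2 `^ p * b `^ p * t.1.1)%:E)%E].
  have Hv := subcube_child v Ha.
  have va : cbox (childv a l v) (l / 2) `<=` cbox a l by exact: cbox_child.
  have ov := osc_anti Hv Ha va; have ov0 := osc_gt0 Hv.
  have [near_v|stop] := leP `|c (childv a l v) (l / 2) - x|
      (osc (childv a l v) (l / 2) + osc a' l').
    have [||u [X [Y [? ? ? ? ?]]]] :=
      relN E0 a' l' _ _ y' b Ha' Hv E0E (subset_trans va aa') near_v.
    - by rewrite y'0; lra.
    - by [].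
    - by exists (u, X, Y).
  (* A stopped child is handed over to own_bound, with b raised by the jump. *)
  exists ((l / 2) ^+ n, 0, I (childv a l v) (l / 2)); split => /=.
  - by rewrite exprn_ge0// ltW.
  - by rewrite add0r.
  - by rewrite subrr mulr0.
  - exact: stopping_mass E0E stop.
  pose b' := b + kk * osc (childv a l v) (l / 2).
  have kk0 : 0 <= kk by rewrite addr_ge0.
  have kkv : 0 <= kk * osc (childv a l v) (l / 2) by rewrite mulr_ge0// ltW.
  have b'0 : 0 <= b' by rewrite addr_ge0.
  have kb : `|c (childv a l v) (l / 2) - x| <= kk * osc (childv a l v) (l / 2).
    have := child_constant v Ha.
    have := ler_distD (c a l) (c (childv a l v) (l / 2)) x.
    by rewrite /kk mulrDl /x; lra.
  have yk : y' <= 0 + kk * osc (childv a l v) (l / 2).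
    rewrite add0r (le_trans y'2)// ler_pM ?(ltW o0)//.
    by rewrite /kk lerDr.
  apply: le_trans (_ : _ <= J (c (childv a l v) (l / 2)) N 0 b' _ _)%E _.
    apply: ge0_le_integral => //.
    - exact: measurable_box.
    - by move=> z _; rewrite lee_fin powR_ge0.
    move=> z _; rewrite lee_fin le_powR//.
      by rewrite addr_ge0// (le_trans y'0)// pathmax_ge.
    rewrite /b' (addrC b) addrA lerD2r; apply: pathmax_le => // a1 l1.
    rewrite /dev; have := ler_distD (c (childv a l v) (l / 2)) (c a1 l1) x; lra.
  apply: (le_trans (ownN _ _ _ Hv b'0)); rewrite lee_fin mulr0 add0r.
  have := powRD_le p0 b0 kkv; rewrite powRM ?(ltW ov0)// -/b' => b'p.
  have ln0 : 0 <= (l / 2) ^+ n by rewrite exprn_ge0// ltW.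
  have := ler_wpM2r ln0 (ler_wpM2l (ltW B_gt0) b'p).
  have : 0 <= 2 `^ p * b `^ p * (l / 2) ^+ n by rewrite !mulr_ge0 ?powR_ge0.
  rewrite /D; lra.
have [t /= Ht] := choice child.
exists (\sum_v (t v).1.1), (\sum_v (t v).1.2), (\sum_v (t v).2); split.
- by apply: sumr_ge0 => v _; have [] := Ht v.
- by rewrite -big_split I_children//; apply: eq_bigr => v _; have [] := Ht v.
- rewrite -(sum_children_vol (n := n) l) -sumrB mulr_sumr.
  by apply: ler_sum => v _; have [] := Ht v.
- rewrite measure_children//; last by rewrite E0E; exact: measurable_deviation.
  by rewrite mulr_sumr -sumEFin; apply: lee_sum => v _; have [] := Ht v.
rewrite J_children// -(sum_children_vol (n := n) l) !mulr_sumr -!big_split /=.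
by rewrite -sumEFin; apply: lee_sum => v _; have [] := Ht v.
Qed.

Let own_of_relative N : relative_bound N -> own_bound N.
Proof.
move=> relN a l b Ha b0; have l0 := Ha.1; have o0 := osc_gt0 Ha.
have [||u [X [Y [u0 XY Xge umu J_le]]]] :=
  relN _ a l a l 0 b Ha Ha erefl (@subset_refl _ _) _ _ b0.
- by rewrite subrr normr0 addr_ge0// ltW.
- by rewrite lexx mulr_ge0// ltW.
apply: (le_trans J_le).
have us : (1 - s) * u <= s * l ^+ n.
  rewrite -lee_fin (le_trans umu)// (le_trans _ (osc_le Ha))//.
  apply: le_measure; rewrite ?inE.
  - by apply: measurableI; [exact: measurable_deviation|exact: measurable_box].
  - exact: measurable_far.
  - by move=> z [? ?]; split => //; exact: box_cbox.
have ut : u <= theta * l ^+ n.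
  by rewrite /theta mulrAC ler_pdivlMr ?subr_gt0// mulrC.
rewrite lee_fin -XY.
have op0 := powR_ge0 (osc a l) p; have bp0 := powR_ge0 b p.
have th0 : 0 < 1 - theta by rewrite subr_gt0.
have : D * (osc a l `^ p * l ^+ n) <= D / (1 - theta) * X.
  rewrite -[leRHS]mulrA ler_wpM2l// [leRHS]mulrC ler_pdivlMr//.
  apply: le_trans Xge; rewrite -mulrA ler_wpM2l//; lra.
have B2_ge0 : 0 <= B * 2 `^ p by apply: mulr_ge0 (powR_ge0 _ _); exact: ltW.
have := ler_wpM2l B2_ge0 (ler_wpM2l bp0 ut).
have := congr1 (fun x => x * (b `^ p * l ^+ n)) BE.
rewrite /A /recursion_constant; lra.
Qed.

(** The case b = 0 of the bound of each cube relative to its own constant. *)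
Lemma pathmax_integral_le N a l : subcube a l ->
  (\int[mu]_(z in box a l) ((pathmax (fun a' l' => `|c a' l' - c a l|) N 0 a l z) `^ p)%:E <=
   (recursion_constant * I a l)%:E)%E.
Proof.
move=> Ha; have bounds : relative_bound N /\ own_bound N.
  elim: N => [|N [relN ownN]].
    by split; [exact: relative_bound_leaf|exact: own_of_relative relative_bound_leaf].
  have relN1 := relative_bound_step relN ownN.
  by split; [exact: relN1|exact: own_of_relative relN1].
have := bounds.2 a l 0 Ha (lexx _); rewrite /J.
under eq_integral do rewrite addr0.
move=> J_le; apply: (le_trans J_le); rewrite lee_fin powR0 ?gt_eqF// mulr0 mul0r addr0.
rewrite lerBlDr lerDl; apply: mulr_ge0; last by rewrite exprn_ge0// ltW// Ha.1.
exact: mulr_ge0 D_ge0 (powR_ge0 _ _).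
Qed.

End recursion.

End stopping_cubes.

(** * The local oscillation inequality *)

Section local_oscillation.
Context {R : realType} {n : nat} {d} {E : measurableType d}
  {mu : {measure set E -> \bar R}} (K : coordinates n mu) (n_gt0 : (0 < n)%N).
Notation pt := (n.-tuple R).
Notation dir := {ffun 'I_n -> bool}.
Notation box := (box K).
Notation cbox := (cbox K).
Notation desc := (desc K).
Notation pathmax := (pathmax K).

Variables (g : E -> R) (c osc : pt -> R -> R) (s : R) (a0 : pt) (l0 : R).
Let top := cbox a0 l0.
Notation subcube := (subcube K top).
Hypothesis dens : dyadic_density K.
Hypothesis mg : measurable_fun [set: E] g.
Hypotheses (s0 : 0 < s) (s3 : 3 * s < 1) (l0_gt0 : 0 < l0).
Variable eps : R.
Hypothesis eps_gt0 : 0 < eps.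
Hypothesis osc_ge : forall a l, subcube a l -> eps <= osc a l.
Hypothesis osc_anti : forall a l a' l', subcube a l -> subcube a' l' ->
  cbox a l `<=` cbox a' l' -> osc a' l' <= osc a l.
Hypothesis osc_le : forall a l, subcube a l ->
  (mu (far K g c osc a l) <= (s * l ^+ n)%:E)%E.
Variables (p : R) (Phi : E -> \bar R).
Hypotheses (p_gt0 : 0 < p) (p_small : 2 `^ p * (s / (1 - s)) < 1).
Hypothesis mPhi : measurable_fun [set: E] Phi.
Hypothesis osc_Phi : forall a l z, subcube a l -> box a l z ->
  ((osc a l `^ p)%:E <= Phi z)%E.
Hypothesis Phi_ge0 : forall z, (0 <= Phi z)%E.
Hypothesis Phi_int : (\int[mu]_(z in top) Phi z < +oo)%E.

Let subcube_top : subcube a0 l0. Proof. by split. Qed.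

Let osc_gt0 a l : subcube a l -> 0 < osc a l.
Proof. by move/osc_ge; apply: lt_le_trans. Qed.

Let mass a l := fine (\int[mu]_(z in box a l) Phi z)%E.

Let Phi_fin a l : subcube a l -> (\int[mu]_(z in box a l) Phi z)%E \is a fin_num.
Proof.
move=> [_ atop]; rewrite ge0_fin_numE; last first.
  by apply: integral_ge0 => z _; exact: Phi_ge0.
apply: le_lt_trans Phi_int; apply: ge0_subset_integral.
- exact: measurable_box.
- exact: measurable_cbox.
- exact: measurable_funTS.
- by move=> z _; exact: Phi_ge0.
- by apply: subset_trans atop; exact: box_cbox.
Qed.

Let I_children a l : subcube a l -> mass a l = \sum_(v : dir) mass (childv a l v) (l / 2).
Proof.
move=> Ha; apply: EFin_inj; rewrite -sumEFin /mass fineK; last exact: Phi_fin.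
rewrite (@ge0_integral_children _ _ _ _ _ K _ _ Phi Ha.1).
- apply: eq_bigr => v _; rewrite fineK//; apply: Phi_fin; exact: subcube_child.
- exact: measurable_funTS.
- by move=> z _; exact: Phi_ge0.
Qed.

Let I_ge a l : subcube a l -> osc a l `^ p * l ^+ n <= mass a l.
Proof.
move=> Ha; rewrite -lee_fin /mass fineK; last exact: Phi_fin.
have -> : ((osc a l `^ p * l ^+ n)%:E =
    \int[mu]_(z in box a l) (cst (osc a l `^ p)%:E z))%E.
  by rewrite integral_cst ?mu_box ?Ha.1//; exact: measurable_box.
apply: ge0_le_integral.
- exact: measurable_box.
- by move=> z _; rewrite lee_fin powR_ge0.
- exact: measurable_cst.
- exact: measurable_funTS.
- by move=> z za; exact: osc_Phi.
Qed.

Let level (k : int) : set E := [set z | k%:~R * eps <= g z < (k + 1)%:~R * eps].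

Let m_level k : measurable (level k).
Proof.
rewrite (_ : level k = g @^-1` `[k%:~R * eps, (k + 1)%:~R * eps[).
  by rewrite -[X in measurable X]setTI; exact: mg.
by apply/seteqP; split => z /=; rewrite in_itv.
Qed.

(* Points of the k-th band of values of g around which the band is sparse at all
   dyadic scales; elsewhere some dyadic box is not sparse. *)
Let bad (k : int) : set E := box a0 l0 `&` level k `&` \bigcap_N
  [set z | (mu (level k `&` box (desc N a0 l0 z) (l0 / 2 ^+ N)) <=
    (s * (l0 / 2 ^+ N) ^+ n)%:E)%E].

Let m_bad k : measurable (bad k).
Proof.
apply: measurableI.
  by apply: measurableI; [exact: measurable_box|exact: m_level].
apply: bigcap_measurable => // N _.
set F := fun a => mu (level k `&` box a (l0 / 2 ^+ N)).
have mF : measurable_fun [set: E] (fun z => F (desc N a0 l0 z)).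
  exact: measurable_fun_desc.
rewrite -[X in measurable X]setTI.
exact: emeasurable_fun_infty_c.
Qed.

Let bad0 k : mu (bad k) = 0.
Proof.
apply: (dens (a := a0) (l := l0) (s := s)) => //.
- by rewrite s0/=; move: s0 s3; lra.
- by move=> z [[]].
move=> z N [_ /(_ N I)]; apply: le_trans; apply: le_measure; rewrite ?inE.
- by apply: measurableI => //; exact: measurable_box.
- by apply: measurableI => //; exact: measurable_box.
- by apply: setSI => w [[]].
Qed.

Let bads : set E := \bigcup_j (if unpickle j is Some k then bad k else set0).

Let m_bads : measurable bads.
Proof. by apply: bigcupT_measurable => j; case: unpickle. Qed.

Let bads0 : mu bads = 0.
Proof.
have : mu.-negligible bads.
  apply: negligible_bigcup => j; case: unpickle => [k|]; last exact: negligible_set0.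
  by exists (bad k); split.
by move=> neg; exact: (measure_negligible m_bads neg).
Qed.

Let G N z := pathmax (fun a l => `|c a l - c a0 l0|) N 0 a0 l0 z.

Let G_ge0 N z : 0 <= G N z.
Proof. exact: pathmax_ge. Qed.

Let Gp N z := ((G N z) `^ p)%:E.

Let nd_Gp z : nondecreasing_seq (Gp ^~ z).
Proof.
move=> N M NM; rewrite lee_fin le_powR//; first exact: ltW.
exact: pathmax_homo.
Qed.

Let mGp N : measurable_fun [set: E] (Gp N).
Proof.
apply/measurable_EFinP; apply: (measurableT_comp (measurable_powR p)).
exact: measurable_pathmax.
Qed.

Let Gp_lim z : Gp ^~ z @ \oo --> ereal_sup (range (Gp ^~ z)).
Proof. exact: ereal_nondecreasing_cvgn. Qed.

Let good_bound z : box a0 l0 z -> ~ bads z ->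
  ((`|g z - c a0 l0| `^ p)%:E <=
   (2 `^ p)%:E * ((2 `^ p)%:E * Phi z + limn (Gp ^~ z)))%E.
Proof.
move=> za nbad; pose k := Num.floor (g z / eps).
have zk : level k z.
  rewrite /level /= -ler_pdivlMr// -ltr_pdivrMr//.
  by rewrite floor_le_tmp lt_succ_floor.
have [N] : exists N, ~ (mu (level k `&` box (desc N a0 l0 z) (l0 / 2 ^+ N)) <=
    (s * (l0 / 2 ^+ N) ^+ n)%:E)%E.
  apply/existsNP => allN; apply: nbad; exists (pickle k); first exact: Logic.I.
  by rewrite pickleK; split => [|N _]; [split|exact: allN].
set b := desc N a0 l0 z; set m := l0 / 2 ^+ N => large.
have Hb : subcube b m by exact: subcube_desc.
have [w [[wk wb] wfar]] : exists w, (level k `&` box b m) w /\ ~ far K g c osc b m w.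
  apply: contrapT => /forallNP now; apply: large.
  apply: le_trans (osc_le Hb); apply: le_measure; rewrite ?inE.
  - by apply: measurableI; [exact: m_level|exact: measurable_box].
  - exact: measurable_far.
  - by move=> w lw; apply: contrapT => wf; apply: (now w).
have gw : `|g w - c b m| <= osc b m.
  rewrite leNgt; apply/negP => h; apply: wfar; split => //; exact: box_cbox.
have gg : `|g z - g w| <= eps.
  move: zk wk; rewrite /level /= intrD mulrDl mul1r ler_norml; lra.
have ge_osc := osc_ge Hb.
have bound : `|g z - c a0 l0| <= 2 * osc b m + G N z.
  have GN : `|c b m - c a0 l0| <= G N z.
    exact: (pathmax_desc K (fun a l => `|c a l - c a0 l0|) 0 a0 l0 z (leqnn N)).
  have := ler_distD (g w) (g z) (c a0 l0).
  have := ler_distD (c b m) (g w) (c a0 l0); lra.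
have zb : box b m z by exact: in_desc.
apply: (@le_trans _ _ ((2 `^ p * (2 `^ p * osc b m `^ p + G N z `^ p))%:E)).
  rewrite lee_fin -powRM ?(ltW (osc_gt0 Hb))//.
  apply: le_trans (powRD_le (ltW p_gt0) _ (G_ge0 N z)).
    by apply: le_powR => //; exact: ltW.
  by rewrite mulr_ge0// ltW// osc_gt0.
rewrite EFinM lee_pmul2l ?lte_fin ?powR_gt0// EFinD; apply: leeD.
  rewrite EFinM lee_pmul2l ?lte_fin ?powR_gt0//; exact: osc_Phi.
rewrite (cvg_lim _ (@Gp_lim z))//; apply: ereal_sup_ubound.
by exists N.
Qed.

Definition local_constant :=
  2 `^ p * (2 `^ p + recursion_constant (n := n) s p).

Lemma local_constant_ge0 : 0 <= local_constant.
Proof.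
rewrite mulr_ge0 ?powR_ge0// addr_ge0 ?powR_ge0//.
exact: recursion_constant_ge0.
Qed.

(** At almost every point z some dyadic box contains many points at which g is
    within eps of g z; one of them is not exceptional, hence g z is close to the
    constant of that box. So |g - c| is at most twice the oscillation bound plus
    the supremum of the differences of constants, whose integral is controlled by
    [pathmax_integral_le] and monotone convergence. *)
Lemma local_oscillation :
  (\int[mu]_(z in box a0 l0) (`|g z - c a0 l0| `^ p)%:E <=
    local_constant%:E * \int[mu]_(z in box a0 l0) Phi z)%E.
Proof.
have mbox0 : measurable (box a0 l0) by exact: measurable_box.
have m_int : measurable_fun [set: E] (fun z => (`|g z - c a0 l0| `^ p)%:E).
  apply/measurable_EFinP; apply: (measurableT_comp (measurable_powR p)).
  by apply: measurableT_comp => //; exact: measurable_funB.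
have m_lim : measurable_fun [set: E] (fun z => limn (Gp ^~ z)).
  apply: (@emeasurable_fun_cvg _ _ _ [set: E] Gp _ mGp) => z _.
  by apply: ereal_nondecreasing_is_cvgn; exact: nd_Gp.
have lim_ge0 z : (0 <= limn (Gp ^~ z))%E.
  apply: lime_ge; first by apply: ereal_nondecreasing_is_cvgn; exact: nd_Gp.
  by apply: nearW => N; rewrite lee_fin powR_ge0.
have m_Phi2 : measurable_fun [set: E] (fun z => (2 `^ p)%:E * Phi z)%E.
  exact: measurable_funeM.
have Phi2_ge0 z : (0 <= (2 `^ p)%:E * Phi z)%E.
  by rewrite mule_ge0 ?lee_fin ?powR_ge0.
rewrite (ge0_negligible_integral m_bads mbox0 (measurable_funTS m_int) _ bads0);
  last by move=> z _; rewrite lee_fin powR_ge0.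
have m_rhs : measurable_fun [set: E]
   (fun z => (2 `^ p)%:E * ((2 `^ p)%:E * Phi z + limn (Gp ^~ z)))%E.
  by apply: measurable_funeM; apply: emeasurable_funD.
have rhs_ge0 z :
    (0 <= (2 `^ p)%:E * ((2 `^ p)%:E * Phi z + limn (Gp ^~ z)))%E.
  by rewrite mule_ge0 ?lee_fin ?powR_ge0// adde_ge0.
apply: (@le_trans _ _ (\int[mu]_(z in box a0 l0)
   ((2 `^ p)%:E * ((2 `^ p)%:E * Phi z + limn (Gp ^~ z))))%E).
  apply: (@le_trans _ _ (\int[mu]_(z in box a0 l0 `\` bads)
   ((2 `^ p)%:E * ((2 `^ p)%:E * Phi z + limn (Gp ^~ z))))%E).
    apply: ge0_le_integral.
    - exact: measurableD.
    - by move=> z _; rewrite lee_fin powR_ge0.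
    - exact: measurable_funTS.
    - exact: measurable_funTS.
    - by move=> z [za zb]; exact: good_bound.
  apply: ge0_subset_integral => //.
  - exact: measurableD.
  - exact: measurable_funTS.
have m_sum := emeasurable_funD m_Phi2 m_lim.
rewrite (ge0_integralZl mu mbox0 (measurable_funTS m_sum)); last 2 first.
- by move=> z _; rewrite adde_ge0.
- by rewrite lee_fin powR_ge0.
rewrite (ge0_integralD mu mbox0 _ (measurable_funTS m_Phi2) _ (measurable_funTS m_lim)) //.
rewrite (ge0_integralZl mu mbox0 (measurable_funTS mPhi)) ?lee_fin ?powR_ge0//.
rewrite (monotone_convergence mu mbox0 (fun N => measurable_funTS (mGp N))); last 2 first.
- by move=> N z _; rewrite lee_fin powR_ge0.
- by move=> z _; exact: nd_Gp.
rewrite -(fineK (Phi_fin subcube_top)) -!EFinM.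
apply: (@le_trans _ _ ((2 `^ p)%:E * ((2 `^ p * mass a0 l0)%:E +
    (recursion_constant (n := n) s p * mass a0 l0)%:E))%E).
  rewrite lee_pmul2l ?lte_fin ?powR_gt0//; apply: leeD => //.
  apply: lime_le.
    apply: ereal_nondecreasing_is_cvgn => N M NM.
    apply: ge0_le_integral => //.
    - by move=> z _; rewrite lee_fin powR_ge0.
    - exact: measurable_funTS.
    - exact: measurable_funTS.
    - by move=> z _; exact: nd_Gp.
  apply: nearW => N.
  exact: (pathmax_integral_le n_gt0 mg s0 s3 osc_gt0 osc_anti osc_le p_gt0
    I_children I_ge p_small).
rewrite -EFinD -EFinM lee_fin /local_constant /mass; lra.
Qed.

End local_oscillation.

(** * Integrals of the dyadic maximal function *)

Section dyadic_maximal.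
Context {R : realType} {n : nat} {d} {E : measurableType d}
  {mu : {measure set E -> \bar R}} (K : coordinates n mu).
Notation pt := (n.-tuple R).
Notation dir := {ffun 'I_n -> bool}.
Notation box := (box K).
Notation cbox := (cbox K).
Notation pathmax := (pathmax K).

Variable h : E -> R.

Definition boxmean (a : pt) (l : R) : R :=
  fine (\int[mu]_(z in box a l) (h z)%:E)%E / l ^+ n.

Section bellman.
Variables (top : set E) (w : R -> R) (Psi : R -> E -> R).
Notation subcube := (subcube K top).
Hypothesis mw : measurable_fun [set: R] w.
Hypothesis w_ge0 : forall y, 0 < y -> 0 <= w y.
Hypothesis w_homo : forall x y, 0 < x -> x <= y -> w x <= w y.
Hypothesis mPsi : forall y, measurable_fun [set: E] (Psi y).
Hypothesis Psi_ge0 : forall y z, 0 < y -> 0 <= Psi y z.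
Hypothesis Psi_step : forall a l y, subcube a l -> 0 < y -> y < boxmean a l ->
  ((w (boxmean a l) * l ^+ n)%:E + \int[mu]_(z in box a l) (Psi (boxmean a l) z)%:E
   <= (w y * l ^+ n)%:E + \int[mu]_(z in box a l) (Psi y z)%:E)%E.

Let step a l y : subcube a l -> 0 < y ->
  ((w (Num.max y (boxmean a l)) * l ^+ n)%:E +
     \int[mu]_(z in box a l) (Psi (Num.max y (boxmean a l)) z)%:E
   <= (w y * l ^+ n)%:E + \int[mu]_(z in box a l) (Psi y z)%:E)%E.
Proof.
move=> Ha y0; have [//|yF] := leP (boxmean a l) y.
exact: Psi_step.
Qed.

Let m_path N y a l : measurable_fun [set: E]
  (fun z => (w (pathmax boxmean N y a l z))%:E).
Proof.
apply/measurable_EFinP; apply: (measurableT_comp mw).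
exact: measurable_pathmax.
Qed.

Let w_path_ge0 N y a l z : 0 < y -> (0 <= (w (pathmax boxmean N y a l z))%:E)%E.
Proof.
by move=> y0; rewrite lee_fin w_ge0// (lt_le_trans y0)// pathmax_ge.
Qed.

Lemma bellman_finite N y a l : subcube a l -> 0 < y ->
  (\int[mu]_(z in box a l) (w (pathmax boxmean N y a l z))%:E <=
   (w y * l ^+ n)%:E + \int[mu]_(z in box a l) (Psi y z)%:E)%E.
Proof.
elim: N y a l => [|N IH] y a l Ha y0; apply: le_trans (step Ha y0);
  have l0 := Ha.1; have y'0 : 0 < Num.max y (boxmean a l) by rewrite lt_max y0.
  rewrite /= integral_cst ?mu_box//; last exact: measurable_box.
  by rewrite -EFinM leeDl// integral_ge0// => z _; rewrite lee_fin Psi_ge0.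
have mPsiE y1 : measurable_fun (box a l) (fun z => (Psi y1 z)%:E).
  by apply: measurable_funTS; exact/measurable_EFinP.
rewrite (@ge0_integral_children _ _ _ _ _ K a l _ l0); last 2 first.
- exact: measurable_funTS.
- by move=> z _; exact: w_path_ge0.
rewrite (@ge0_integral_children _ _ _ _ _ K a l _ l0 (mPsiE _)); last first.
  by move=> z _; rewrite lee_fin Psi_ge0.
rewrite -(sum_children_vol (n := n) l) mulr_sumr -sumEFin -big_split /=.
apply: lee_sum => v _; apply: le_trans (IH _ _ _ (subcube_child v Ha) y'0).
rewrite le_eqVlt; apply/orP; left; apply/eqP.
by apply: eq_integral => z /[!inE] zv; rewrite (sub_child l0 zv).
Qed.

Definition pathsup y a l z := limn (fun N => (w (pathmax boxmean N y a l z))%:E).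

Let nd_path y a l z : 0 < y ->
  nondecreasing_seq (fun N => (w (pathmax boxmean N y a l z))%:E).
Proof.
move=> y0 N M NM; rewrite lee_fin w_homo//; last exact: pathmax_homo.
by rewrite (lt_le_trans y0)// pathmax_ge.
Qed.

Lemma pathsup_ge N y a l z : 0 < y ->
  ((w (pathmax boxmean N y a l z))%:E <= pathsup y a l z)%E.
Proof.
move=> y0; rewrite /pathsup (cvg_lim _ (ereal_nondecreasing_cvgn (@nd_path y a l z y0)))//.
by apply: ereal_sup_ubound; exists N.
Qed.

Lemma measurable_pathsup y a l : 0 < y -> measurable_fun [set: E] (pathsup y a l).
Proof.
move=> y0; apply: (@emeasurable_fun_cvg _ _ _ [set: E]
  (fun N z => (w (pathmax boxmean N y a l z))%:E)) => [N|z _]; first exact: m_path.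
by apply: ereal_nondecreasing_is_cvgn; exact: nd_path.
Qed.

(** If replacing the level y by a larger mean of h never increases the functional
    w y |Q| + int_Q Psi y, then this functional bounds the integral of w of the
    dyadic maximal function started at y: the level is raised along the dyadic
    chain while the second term is additive over children. *)
Lemma bellman y a l : subcube a l -> 0 < y ->
  (\int[mu]_(z in box a l) pathsup y a l z <=
   (w y * l ^+ n)%:E + \int[mu]_(z in box a l) (Psi y z)%:E)%E.
Proof.
move=> Ha y0; have mbox := measurable_box K a l.
rewrite /pathsup (monotone_convergence mu mbox
  (fun N => measurable_funTS (m_path N y a l))); last 2 first.
- by move=> N z _; exact: w_path_ge0.
- by move=> z _; exact: nd_path.
apply: lime_le; last by apply: nearW => N; exact: bellman_finite.
apply: ereal_nondecreasing_is_cvgn => N M NM; apply: ge0_le_integral => //.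
- by move=> z _; exact: w_path_ge0.
- exact: measurable_funTS.
- exact: measurable_funTS.
- by move=> z _; exact: nd_path.
Qed.

End bellman.

Hypothesis mh : measurable_fun [set: E] h.
Hypothesis h_ge0 : forall z, 0 <= h z.

Let mhE : measurable_fun [set: E] (fun z => (h z)%:E).
Proof. exact/measurable_EFinP. Qed.

Lemma boxmeanE a l : 0 < l -> (\int[mu]_(z in box a l) (h z)%:E < +oo)%E ->
  (\int[mu]_(z in box a l) (h z)%:E = (boxmean a l * l ^+ n)%:E)%E.
Proof.
move=> l0 hoo; rewrite /boxmean divfK ?lt0r_neq0 ?exprn_gt0// fineK//.
by rewrite ge0_fin_numE// integral_ge0// => z _; rewrite lee_fin.
Qed.

Let sub_finite a l a' l' : (\int[mu]_(z in cbox a l) (h z)%:E < +oo)%E ->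
  subcube K (cbox a l) a' l' ->
  (\int[mu]_(z in box a' l') (h z)%:E < +oo)%E.
Proof.
move=> hoo [_ sub]; apply: le_lt_trans hoo; apply: ge0_subset_integral.
- exact: measurable_box.
- exact: measurable_cbox.
- exact: measurable_funTS.
- by move=> z _; rewrite lee_fin.
- by apply: subset_trans sub; exact: box_cbox.
Qed.

Let integral_scale a l (k : R) : 0 < l -> 0 <= k ->
  (\int[mu]_(z in box a l) (h z)%:E < +oo)%E ->
  (\int[mu]_(z in box a l) (k * h z)%:E = (k * (boxmean a l * l ^+ n))%:E)%E.
Proof.
move=> l0 k0 hoo; under eq_integral do rewrite EFinM.
rewrite ge0_integralZl_EFin//.
- by rewrite (boxmeanE l0 hoo).
- exact: measurable_box.
- by move=> z _; rewrite lee_fin.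
- exact: measurable_funTS.
Qed.

Lemma powR_pred (q x : R) : 0 < x -> x `^ (q - 1) * x = x `^ q.
Proof.
move=> x0; rewrite -[X in _ * X](powRr1 (ltW x0)) -powRD ?subrK//.
by apply/implyP => _; rewrite gt_eqF.
Qed.

(** Young's inequality with exponents 1 / q and 1 / (1 - q), applied to (x / y)^q
    and 1: the graph of x^q lies below its tangent at y. *)
Lemma powR_tangent (q x y : R) : 0 < q < 1 -> 0 < x -> 0 < y ->
  x `^ q <= (1 - q) * y `^ q + q * y `^ (q - 1) * x.
Proof.
move=> /andP[q0 q1] x0 y0.
have := @conjugate_powR R ((x / y) `^ q) 1 q^-1 (1 - q)^-1.
rewrite mulr1 powR_ge0 ler01 !invr_gt0 subr_gt0 q0 q1 !invrK subrKC.
move=> /(_ isT isT isT isT erefl).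
rewrite powR1 mul1r -powRrM mulfV ?gt_eqF// powRr1 ?divr_ge0 ?(ltW x0) ?(ltW y0)//.
rewrite powRM ?invr_ge0 ?(ltW x0) ?(ltW y0)// => xy.
have yq : 0 < y `^ q by rewrite powR_gt0.
have E1 : y `^ (q - 1) = y `^ q / y.
  by rewrite -(powR_pred q y0) mulfK// gt_eqF.
have E2 : y^-1 `^ q = (y `^ q)^-1.
  by rewrite -powR_inv1 ?(ltW y0)// -powRrM mulN1r powRN.
move: xy; rewrite E2 ler_pdivrMr// E1.
have -> : (x / y * q + (1 - q)) * y `^ q = (1 - q) * y `^ q + q * (y `^ q / y) * x.
  by ring.
by [].
Qed.

(** [bellman] with Psi linear in h; its step is the tangent inequality
    [powR_tangent]. The constant 1 / (1 - q) is Kolmogorov's. *)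
Lemma dyadic_maximal_pow (q : R) y a l : 0 < q < 1 -> 0 < l -> 0 < y ->
  (\int[mu]_(z in cbox a l) (h z)%:E < +oo)%E -> boxmean a l <= y ->
  (\int[mu]_(z in box a l) pathsup (fun x : R => (x `^ q)%R) y a l z <=
    (y `^ q / (1 - q) * l ^+ n)%:E)%E.
Proof.
move=> /[dup] q01 /andP[q0 q1] l0 y0 hoo Fy; have q1' : 0 < 1 - q by rewrite subr_gt0.
pose k x := q / (1 - q) * x `^ (q - 1).
have k0 x : 0 <= k x by rewrite /k mulr_ge0 ?powR_ge0 ?divr_ge0 ?ltW.
have Ha : subcube K (cbox a l) a l by split.
have aoo := sub_finite hoo Ha.
apply: (le_trans (bellman (top := cbox a l) (Psi := fun x z => k x * h z) _ _ _ _ _ _ Ha y0)).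
- exact: measurable_powR.
- by move=> *; exact: powR_ge0.
- by move=> x x' x0 xx'; rewrite le_powR// ltW.
- by move=> x; exact: measurable_funM.
- by move=> x z _; rewrite mulr_ge0.
- move=> b m x Hb x0 xF; have boo := sub_finite hoo Hb; have m0 := Hb.1.
  have F0 : 0 < boxmean b m by exact: lt_trans xF.
  rewrite !(integral_scale m0 _ boo)//.
  rewrite -!EFinD lee_fin.
  have assoc u v x1 : u * m ^+ n + v * (x1 * m ^+ n) = (u + v * x1) * m ^+ n.
    by ring.
  rewrite !assoc ler_wpM2r ?exprn_ge0 ?(ltW m0)//.
  rewrite -(ler_pM2l q1').
  have -> : (1 - q) * (x `^ q + k x * boxmean b m) =
      (1 - q) * x `^ q + q * x `^ (q - 1) * boxmean b m.
    by rewrite /k; field; rewrite gt_eqF.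
  apply: le_trans (powR_tangent q01 F0 x0).
  have FF : boxmean b m `^ (q - 1) * boxmean b m = boxmean b m `^ q.
    exact: powR_pred.
  have -> : (1 - q) * (boxmean b m `^ q + k (boxmean b m) * boxmean b m) =
      (1 - q) * boxmean b m `^ q + q * (boxmean b m `^ (q - 1) * boxmean b m).
    by rewrite /k; field; rewrite gt_eqF.
  by rewrite FF; lra.
rewrite (integral_scale l0 _ aoo)// -EFinD lee_fin mulrA -mulrDl.
rewrite ler_wpM2r ?exprn_ge0 ?(ltW l0)//.
have yy : y `^ (q - 1) * y = y `^ q.
  exact: powR_pred.
apply: (@le_trans _ _ (y `^ q + k y * y)); first by rewrite lerD2l ler_wpM2l.
by rewrite /k -mulrA yy le_eqVlt; apply/orP; left; apply/eqP; field; rewrite gt_eqF.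
Qed.

Lemma ln_ratio_ge (x y : R) : 0 < x -> 0 < y -> x - y <= x * ln (x / y).
Proof.
move=> x0 y0; have yx : 0 < y / x by rewrite divr_gt0.
have h1 : ln (y / x) <= y / x - 1.
  by rewrite -[in X in ln X](subrKC 1 (y / x)) le_ln1Dx//; lra.
have -> : ln (x / y) = - ln (y / x) by rewrite -lnV ?posrE ?divr_gt0// invf_div.
have := ler_wpM2l (ltW x0) h1; rewrite mulrBr mulr1 mulrCA divff ?gt_eqF// mulr1; lra.
Qed.

(** The term y makes the Bellman potential 2 x ln (x / y) + y nonnegative, so that
    all integrals below are integrals of nonnegative functions. *)
Definition entropy (y x : R) := 2 * x * ln (x / y) + y.

Lemma entropy_ge0 y x : 0 < y -> 0 <= x -> 0 <= entropy y x.
Proof.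
move=> y0; rewrite le_eqVlt => /predU1P[<-|x0].
  by rewrite /entropy mulr0 mul0r add0r ltW.
have y20 : 0 < y / 2 by rewrite divr_gt0.
have h1 := ln_ratio_ge x0 y20.
have ln2 : ln 2 <= 1 :> R by apply: (@le_ln1Dx R 1); lra.
have := ler_wpM2l (ltW x0) ln2.
have E1 : x / (y / 2) = 2 * (x / y) by field; rewrite gt_eqF.
move: h1; rewrite E1 lnM ?posrE ?divr_gt0//.
rewrite /entropy mulrDr; lra.
Qed.

Lemma measurable_entropy y : measurable_fun [set: E] (fun z => entropy y (h z)).
Proof.
apply: measurable_funD => //; apply: measurable_funM; first exact: measurable_funM.
apply: (measurableT_comp (@measurable_ln R)); exact: measurable_funM.
Qed.

(** [bellman] with the entropy as Psi. Raising the level from x to the mean X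
    of h lowers the potential by 2 X ln (X / x) on average, up to a difference of
    levels, and X ln (X / x) >= X - x. *)
Lemma dyadic_maximal_entropy y a l : 0 < l -> 0 < y ->
  (\int[mu]_(z in cbox a l) (h z)%:E < +oo)%E ->
  (\int[mu]_(z in box a l) pathsup (fun x : R => (x `^ 1)%R) y a l z <=
    (y * l ^+ n)%:E + \int[mu]_(z in box a l) (entropy y (h z))%:E)%E.
Proof.
move=> l0 y0 hoo; have Ha : subcube K (cbox a l) a l by split.
rewrite -[X in (X * l ^+ n)%:E](powRr1 (ltW y0)).
apply: (bellman (top := cbox a l) (w := fun x : R => x `^ 1)
  (Psi := fun x z => entropy x (h z)) _ _ _ _ _ _ Ha y0).
- exact: measurable_powR.
- by move=> *; exact: powR_ge0.
- by move=> x x' x0 xx'; rewrite le_powR// ltW.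
- exact: measurable_entropy.
- by move=> x z x0; exact: entropy_ge0.
move=> b m x Hb x0; set X := boxmean b m => xX.
have boo := sub_finite hoo Hb; have m0 := Hb.1.
have X0 : 0 < X by exact: lt_trans xX.
rewrite !powRr1 ?(ltW X0) ?(ltW x0)//.
have mb := measurable_box K b m.
have lnX0 : 0 <= ln (X / x).
  by rewrite ln_ge0// ler_pdivlMr// mul1r ltW.
have identity :
  (\int[mu]_(z in box b m) (entropy x (h z))%:E + ((X - x) * m ^+ n)%:E =
   \int[mu]_(z in box b m) (entropy X (h z))%:E +
     (2 * ln (X / x) * (X * m ^+ n))%:E)%E.
  rewrite -(integral_scale m0 _ boo) ?mulr_ge0//.
  have -> : (((X - x) * m ^+ n)%:E = \int[mu]_(z in box b m) (cst (X - x)%:E z))%E.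
    by rewrite integral_cst ?mu_box.
  have mE1 u : measurable_fun (box b m) (fun z => (entropy u (h z))%:E).
    by apply: measurable_funTS; apply/measurable_EFinP; exact: measurable_entropy.
  have mk : measurable_fun (box b m) (fun z => (2 * ln (X / x) * h z)%:E).
    by apply: measurable_funTS; apply/measurable_EFinP; exact: measurable_funM.
  rewrite -(ge0_integralD mu mb _ (mE1 x))//; last 2 first.
  - by move=> z _; rewrite lee_fin entropy_ge0.
  - by move=> z _; rewrite lee_fin subr_ge0 ltW.
  rewrite -(ge0_integralD mu mb _ (mE1 X) _ mk)//; last 2 first.
  - by move=> z _; rewrite lee_fin entropy_ge0.
  - by move=> z _; rewrite lee_fin !mulr_ge0.
  apply: eq_integral => z _; rewrite -!EFinD; congr EFin.
  rewrite /entropy; have := h_ge0 z; rewrite le_eqVlt => /predU1P[<-|hz].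
    by rewrite !mulr0 !mul0r; ring.
  rewrite [in RHS]lnM ?posrE ?invr_gt0// [in LHS]lnM ?posrE ?invr_gt0//.
  by rewrite (@lnM _ X) ?posrE ?invr_gt0// !lnV ?posrE//; ring.
have mono : (X * m ^+ n + (X - x) * m ^+ n <=
    x * m ^+ n + 2 * ln (X / x) * (X * m ^+ n))%R.
  have -> : 2 * ln (X / x) * (X * m ^+ n) = 2 * (X * ln (X / x)) * m ^+ n by ring.
  rewrite -!mulrDl ler_wpM2r ?exprn_ge0 ?(ltW m0)//.
  by have := ln_ratio_ge X0 x0; lra.
rewrite -(@leeD2rE _ ((X - x) * m ^+ n)%:E)// -[leRHS]addeA identity.
rewrite addeAC -EFinD [leRHS]addeCA -EFinD [leRHS]addeC.
by apply: leeD.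
Qed.

End dyadic_maximal.

(** * Cubes inside boxes of shifted dyadic grids *)

Section one_dimensional_grids.
Context {R : realType}.

Fixpoint desc1 N (a l x : R) : R :=
  if N is N'.+1 then
    desc1 N' (if a + l / 2 <= x then a + l / 2 else a) (l / 2) x
  else a.

Lemma desc1_grid N a l x : exists i : nat, desc1 N a l x = a + i%:R * (l / 2 ^+ N).
Proof.
elim: N a l => [|N IH] a l /=; first by exists 0%N; rewrite mul0r addr0.
have [i ->] := IH (if a + l / 2 <= x then a + l / 2 else a) (l / 2).
have two_n0 : (2 : R) ^+ N != 0 by rewrite expf_neq0.
case: ifP => _; last by exists i; rewrite exprS; field.
by exists (i + 2 ^ N)%N; rewrite natrD natrX exprS; field.
Qed.

(** The endpoints of the two grids are never closer than delta / 3: their distance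
    is (2^N + 3 e) delta / 3 for an integer e, and 3 does not divide 2^N. An
    interval shorter than delta / 3 thus meets endpoints of at most one grid. *)
Lemma one_third (N : nat) (l a0 b0 b1 z u m : R) (i0 i1 : nat) :
  let delta := 6 * l / 2 ^+ N in
  0 < delta -> b0 = a0 + i0%:R * delta -> b1 = a0 - 2 * l + i1%:R * delta ->
  b0 <= z < b0 + delta -> b1 <= z < b1 + delta ->
  u <= z <= u + m -> 3 * m < delta ->
  (b0 <= u /\ u + m < b0 + delta) \/ (b1 <= u /\ u + m < b1 + delta).
Proof.
move=> delta d0 b0E b1E z0 z1 zu m3.
have l2 : 2 * l = (2 ^ N)%:R * (delta / 3).
  rewrite /delta natrX; field; by rewrite expf_neq0.
have d3 : 0 < delta / 3 by lra.
have far (e : int) : m < `|2 * l + e%:~R * delta|.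
  pose k : int := (2 ^ N)%:Z + 3 * e.
  have -> : 2 * l + e%:~R * delta = k%:~R * (delta / 3).
    by rewrite l2 /k intrD intrM; field.
  rewrite normrM [X in _ * X]gtr0_norm//.
  apply: (@lt_le_trans _ _ (delta / 3)); first by lra.
  rewrite ler_peMl ?(ltW d3)//.
  have k0 : k != 0.
    apply/negP => /eqP e3.
    have : (3 %| 2 ^ N)%N by apply/dvdnP; exists `|e|%N; move: e3; rewrite /k; lia.
    by rewrite Euclid_dvdX.
  have [k1|k1] : 1 <= k \/ k <= -1 by lia.
    by apply: le_trans (ler_norm _); rewrite ler1z.
  by rewrite ler_normr -mulrNz !ler1z lerNr k1 orbT.
have boundary b : b <= z < b + delta ->
    (b <= u /\ u + m < b + delta) \/
    exists e : int, u <= b + e%:~R * delta <= u + m.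
  move=> bz; have [h0|h0] := leP b u; last first.
    by right; exists 0; rewrite mul0r addr0; lra.
  have [h1|h1] := ltP (u + m) (b + delta); first by left.
  by right; exists 1; rewrite mul1r; lra.
have [?|[e0 h0]] := boundary b0 z0; first by left.
have [?|[e1 h1]] := boundary b1 z1; first by right.
exfalso; have := far (i0%:Z - i1%:Z + e0 - e1).
have -> : 2 * l + (i0%:Z - i1%:Z + e0 - e1)%:~R * delta =
    (b0 + e0%:~R * delta) - (b1 + e1%:~R * delta).
  by rewrite b0E b1E !(intrB, intrD); ring.
rewrite ltNge => /negP; apply; rewrite ler_norml; lra.
Qed.

End one_dimensional_grids.

Section adjacent_grids.
Context {R : realType} {n : nat} {d} {E : measurableType d}
  {mu : {measure set E -> \bar R}} (K : coordinates n mu).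
Notation pt := (n.-tuple R).
Notation dir := {ffun 'I_n -> bool}.
Notation box := (box K).
Notation cbox := (cbox K).
Notation desc := (desc K).
Notation pathmax := (pathmax K).

Lemma tnth_desc N a l z j :
  tnth (desc N a l z) j = desc1 N (tnth a j) l (tnth (crd K z) j).
Proof. by elim: N a l => [|N IH] a l //=; rewrite IH tnth_mktuple ffunE. Qed.

(** The 2^n large boxes of side 6 l around the cube of side l; the shift 2 l is a
    third of the side. *)
Definition shifted_corner (a : pt) (l : R) (v : dir) : pt :=
  [tuple tnth a j - l - (if v j then 2 * l else 0) | j < n].

Lemma shifted_box a l v : 0 < l -> cbox a l `<=` box (shifted_corner a l v) (6 * l).
Proof.
by move=> l0 z za j; have := za j; rewrite tnth_mktuple; case: (v j); lra.
Qed.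

(** The generation N is chosen so that 3 m < 6 l / 2^N <= 6 m; the grid is then
    chosen in each coordinate by [one_third]. *)
Lemma shifted_cover (a u : pt) (l m : R) z : 0 < l -> 0 < m < l ->
  cbox a l z -> cbox u m z -> exists (v : dir) (N : nat),
    6 * l / 2 ^+ N <= 6 * m /\
    cbox u m `<=` box (desc N (shifted_corner a l v) (6 * l) z) (6 * l / 2 ^+ N).
Proof.
move=> l0 /andP[m0 ml] za zu.
have exN : exists N, l / 2 ^+ N <= m.
  exists (Num.bound (l / m)).
  rewrite ler_pdivrMr ?exprn_gt0// mulrC -ler_pdivrMr//.
  apply: (@le_trans _ _ (Num.bound (l / m))%:R).
    by rewrite ltW// archi_boundP// divr_ge0// ltW.
  by rewrite -natrX ler_nat ltnW// ltn_expl.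
have [N Nm Nmin] := ex_minnP exN.
have N0 : (0 < N)%N by case: N Nm {Nmin} => //; rewrite expr0 divr1 leNgt ml.
have m3 : 3 * m < 6 * l / 2 ^+ N.
  have : m < l / 2 ^+ N.-1.
    by rewrite ltNge; apply/negP => /Nmin; rewrite -ltnS prednK// ltnn.
  rewrite -[in X in _ -> X](prednK N0) exprS.
  have -> : 6 * l / (2 * 2 ^+ N.-1) = 3 * (l / 2 ^+ N.-1) by field.
  by rewrite ltr_pM2l.
(* The coordinates of a dyadic corner depend only on the same coordinates of the
   large box, so the grid can be chosen coordinate by coordinate. *)
have choice_j j : exists b : bool, forall x, tnth u j <= x <= tnth u j + m ->
    let b0 := desc1 N (tnth a j - l - (if b then 2 * l else 0)) (6 * l) (tnth (crd K z) j) in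
    b0 <= x < b0 + 6 * l / 2 ^+ N.
  have zj b := in_desc N (shifted_box [ffun=> b] l0 za) j.
  move: (zj false) (zj true); rewrite !tnth_desc !tnth_mktuple !ffunE subr0.
  have [i0 E0] := desc1_grid N (tnth a j - l) (6 * l) (tnth (crd K z) j).
  have [i1 E1] := desc1_grid N (tnth a j - l - 2 * l) (6 * l) (tnth (crd K z) j).
  move=> z0 z1.
  have dN : 0 < 6 * l / 2 ^+ N by rewrite divr_gt0 ?exprn_gt0 ?mulr_gt0.
  have [h|h] := one_third dN E0 E1 z0 z1 (zu j) m3.
    by exists false => x xu; rewrite /= subr0; lra.
  by exists true => x xu /=; lra.
have [b hb] := choice choice_j.
exists [ffun j => b j], N; split.
  by rewrite -mulrA ler_pM2l.
move=> w wu j; have := hb j _ (wu j).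
by rewrite tnth_desc tnth_mktuple ffunE.
Qed.

Variable h : E -> R.
Hypothesis mh : measurable_fun [set: E] h.
Hypothesis h_ge0 : forall z, 0 <= h z.

Let subset_int (A B : set E) : measurable A -> measurable B -> A `<=` B ->
  (\int[mu]_(z in A) (h z)%:E <= \int[mu]_(z in B) (h z)%:E)%E.
Proof.
move=> mA mB AB; apply: ge0_subset_integral => //.
  by apply: measurable_funTS; exact/measurable_EFinP.
by move=> z _; rewrite lee_fin.
Qed.

(** A cube of side at least l which meets the cube of corner a and side l is, after
    tripling, a cube around y, whose average is at most lam. A smaller cube lies
    in a dyadic box, of side at most 6 times larger, of a shifted grid. *)
Lemma average_le_pathmax (a : pt) (l lam : R) (y z : E) : 0 < l -> 0 < lam ->
  cbox a l y -> cbox a l z ->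
  (forall u m, 0 < m -> cbox u m y ->
    (\int[mu]_(x in cbox u m) (h x)%:E <= (lam * m ^+ n)%:E)%E) ->
  forall u m, 0 < m -> cbox u m z -> exists (v : dir) (N : nat),
    (\int[mu]_(x in cbox u m) (h x)%:E <=
     (6 ^+ n * pathmax (boxmean K h) N lam (shifted_corner a l v) (6 * l) z *
       m ^+ n)%:E)%E.
Proof.
move=> l0 lam0 ya za avg u m m0 zu; have [lm|ml] := leP l m.
  exists [ffun=> false], 0%N.
  pose u' : pt := [tuple tnth u j - m | j < n].
  have uu' : cbox u m `<=` cbox u' (3 * m).
    by move=> x xu j; have := xu j; rewrite tnth_mktuple; lra.
  have yu' : cbox u' (3 * m) y.
    move=> j; rewrite tnth_mktuple; have := ya j; have := za j; have := zu j; lra.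
  apply: le_trans (subset_int (measurable_cbox _ _ _) (measurable_cbox _ _ _) uu') _.
  apply: (le_trans (avg _ _ _ yu')); first by rewrite mulr_gt0.
  rewrite lee_fin exprMn mulrA ler_wpM2r ?exprn_ge0 ?(ltW m0)// mulrC.
  rewrite ler_pM ?exprn_ge0 ?(ltW lam0)//.
    by rewrite lerXn2r ?nnegrE// ler_nat.
  exact: pathmax_ge.
have m0l : 0 < m < l by rewrite m0.
have [v [N [Nm uN]]] := shifted_cover l0 m0l za zu.
exists v, N.
set T := shifted_corner a l v; set D := desc N T (6 * l) z in uN.
set delta := 6 * l / 2 ^+ N in uN Nm.
have dN : 0 < delta by rewrite divr_gt0 ?exprn_gt0 ?mulr_gt0.
have Tfin : (\int[mu]_(x in box D delta) (h x)%:E < +oo)%E.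
  have Ty : cbox T (6 * l) y by apply: box_cbox; exact: shifted_box.
  have l6 : 0 < 6 * l by rewrite mulr_gt0.
  apply: (@le_lt_trans _ _ (lam * (6 * l) ^+ n)%:E); last by rewrite ltry.
  apply: le_trans (avg _ _ l6 Ty); apply: subset_int.
  - exact: measurable_box.
  - exact: measurable_cbox.
  - apply: subset_trans (@box_cbox _ _ _ _ _ _ _ _) _.
    have : subcube K (cbox T (6 * l)) D delta by apply: subcube_desc; split.
    by case.
apply: le_trans (subset_int (measurable_cbox _ _ _) (measurable_box _ _ _) uN) _.
rewrite boxmeanE// lee_fin.
have F0 : 0 <= boxmean K h D delta.
  rewrite /boxmean divr_ge0 ?exprn_ge0 ?(ltW dN)// fine_ge0// integral_ge0//.
  by move=> x _; rewrite lee_fin.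
have FP : boxmean K h D delta <= pathmax (boxmean K h) N lam T (6 * l) z.
  exact: (pathmax_desc K (boxmean K h) lam T (6 * l) z (leqnn N)).
rewrite (mulrC (6 ^+ n)) -[leRHS]mulrA -exprMn ler_pM ?exprn_ge0 ?(ltW dN)//.
by rewrite lerXn2r ?nnegrE ?(ltW dN) ?mulr_ge0 ?(ltW m0).
Qed.

End adjacent_grids.

(** * Oscillation of functions with a maximal majorant *)

Section extended_powers.
Context {R : realType}.
Local Open Scope ereal_scope.

Lemma le_poweR (p : R) (x y : \bar R) : (0 <= p)%R -> 0 <= x -> x <= y ->
  x `^ p <= y `^ p.
Proof.
move=> p0 x0 xy; apply: gt0_ler_poweR => //; rewrite in_itv/= leey andbT//.
exact: le_trans xy.
Qed.

Lemma poweRD_le (p : R) (x : \bar R) (y : R) : (0 < p)%R -> 0 <= x -> (0 <= y)%R ->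
  (x + y%:E) `^ p <= (2 `^ p)%:E * (x `^ p + (y `^ p)%:E).
Proof.
move=> p0 + y0; case: x => [x x0| _ |//].
  by rewrite -EFinD !poweR_EFin lee_fin powRD_le// ltW.
by rewrite poweRyr ?gt_eqF// addye// mulry gtr0_sg ?powR_gt0// mul1e leey.
Qed.

End extended_powers.

Section oscillation_of_majorized_functions.
Context {R : realType} {n : nat} {d} {E : measurableType d}
  {mu : {measure set E -> \bar R}} (K : coordinates n mu) (n_gt0 : (0 < n)%N).
Notation pt := (n.-tuple R).
Notation dir := {ffun 'I_n -> bool}.
Notation box := (box K).
Notation cbox := (cbox K).

Hypothesis dens : dyadic_density K.
Variables (a0 : pt) (l0 : R).
Hypothesis l0_gt0 : 0 < l0.
Let top := cbox a0 l0.
Notation subcube := (subcube K top).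
Variables (g : E -> R) (s p kappa : R) (Mr : E -> \bar R).
Hypothesis mg : measurable_fun [set: E] g.
Hypotheses (s0 : 0 < s) (s3 : 3 * s < 1) (p_gt0 : 0 < p).
Hypotheses (p_small : 2 `^ p * (s / (1 - s)) < 1) (kappa_gt0 : 0 < kappa).
Hypothesis Mr_ge0 : forall z, (0 <= Mr z)%E.

Definition inf_cbox (a : pt) (l : R) : \bar R := ereal_inf [set Mr z | z in cbox a l].

Hypothesis exceptional : forall a l, subcube a l -> exists c : R,
  (mu (cbox a l `&` [set z | (kappa%:E * inf_cbox a l < `|g z - c|%:E)%E])
     <= (s * l ^+ n)%:E)%E.

Lemma mu_cboxD a l : 0 < l -> mu (cbox a l `\` box a l) = 0.
Proof.
move=> l_gt0; rewrite measureD; last 3 first.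
- exact: measurable_cbox.
- exact: measurable_box.
- apply: (@le_lt_trans _ _ (l ^+ n)%:E); last exact: ltry.
  by rewrite -(mu_cbox K a l_gt0).
rewrite setIidr; last exact: box_cbox.
transitivity ((l ^+ n)%:E - (l ^+ n)%:E)%E; last by rewrite subee.
by congr (_ - _)%E; [exact: mu_cbox|exact: mu_box].
Qed.

Lemma integral_cbox a l (f : E -> \bar R) : 0 < l ->
  measurable_fun [set: E] f -> (forall z, 0 <= f z)%E ->
  (\int[mu]_(z in cbox a l) f z = \int[mu]_(z in box a l) f z)%E.
Proof.
move=> l_gt0 mf f0; have mD : measurable (cbox a l `\` box a l).
  by apply: measurableD; [exact: measurable_cbox|exact: measurable_box].
rewrite (ge0_negligible_integral mD (measurable_cbox K a l)
  (measurable_funTS mf) (fun z _ => f0 z) (mu_cboxD a l_gt0)).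
by rewrite setDD setIidr//; exact: box_cbox.
Qed.

Lemma inf_cbox_ge0 a l : (0 <= inf_cbox a l)%E.
Proof. by apply: le_ereal_inf_tmp => _ [z _ <-]. Qed.

(** [local_oscillation] for the bounds kappa inf_Q Mr + eps. The infima are finite
    because Psi is integrable; adding eps makes the bounds uniformly positive. *)
Lemma oscillation_by_majorant (eps : R) (Psi : E -> \bar R) : 0 < eps ->
  measurable_fun [set: E] Psi -> (forall z, 0 <= Psi z)%E ->
  (forall z, top z -> ((kappa%:E * Mr z + eps%:E) `^ p <= Psi z)%E) ->
  (\int[mu]_(z in top) Psi z < +oo)%E ->
  exists c : R, (\int[mu]_(z in top) (`|g z - c| `^ p)%:E <=
    (local_constant (n := n) s p)%:E * \int[mu]_(z in top) Psi z)%E.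
Proof.
move=> eps0 mPsi Psi0 Psi_ge Psi_int.
have inf_fin a l : subcube a l -> inf_cbox a l \is a fin_num.
  move=> [l_gt0 atop]; rewrite ge0_fin_numE ?inf_cbox_ge0// ltey.
  apply/negP => /eqP infoo; move: Psi_int; rewrite ltNge => /negP; apply.
  have Psioo z : cbox a l z -> Psi z = +oo%E.
    move=> za; apply/eqP; rewrite -leye_eq; apply: le_trans (Psi_ge z (atop z za)).
    have -> : Mr z = +oo%E.
      apply/eqP; rewrite -leye_eq -infoo; apply: ereal_inf_lbound.
      by exists z.
    by rewrite mulry gtr0_sg// mul1e addye// poweRyr// gt_eqF.
  apply: (@le_trans _ _ (\int[mu]_(z in cbox a l) Psi z)%E); last first.
    apply: ge0_subset_integral => //; try exact: measurable_cbox.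
    exact: measurable_funTS.
  rewrite (@eq_integral _ _ _ mu (cbox a l) (cst +oo%E)); last first.
    by move=> z /[!inE] /Psioo.
  rewrite integral_cst; last exact: measurable_cbox.
  by rewrite mu_cbox// mulyr gtr0_sg ?exprn_gt0// mul1e.
pose osc a l := kappa * fine (inf_cbox a l) + eps.
have oscE a l : subcube a l -> ((osc a l)%:E = kappa%:E * inf_cbox a l + eps%:E)%E.
  by move=> Ha; rewrite /osc EFinD EFinM fineK// inf_fin.
have [c hc] : exists c : pt -> R -> R, forall a l, subcube a l ->
    (mu (cbox a l `&` [set z | (kappa%:E * inf_cbox a l < `|g z - c a l|%:E)%E])
     <= (s * l ^+ n)%:E)%E.
  have H (al : pt * R) : exists c : R, subcube al.1 al.2 ->
      (mu (cbox al.1 al.2 `&`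
        [set z | (kappa%:E * inf_cbox al.1 al.2 < `|g z - c|%:E)%E])
       <= (s * al.2 ^+ n)%:E)%E.
    have [Ha|nHa] := pselect (subcube al.1 al.2); last by exists 0.
    by have [c hc] := exceptional Ha; exists c.
  by have [c hc] := choice H; exists (fun a l => c (a, l)) => a l; exact: (hc (a, l)).
exists (c a0 l0).
have m_dev : measurable_fun [set: E] (fun z => (`|g z - c a0 l0| `^ p)%:E).
  apply/measurable_EFinP; apply: (measurableT_comp (measurable_powR p)).
  by apply: measurableT_comp => //; exact: measurable_funB.
rewrite !integral_cbox//.
apply: (local_oscillation (osc := osc) n_gt0 dens mg s0 s3 l0_gt0 eps0) => //.
- move=> a l Ha; rewrite /osc lerDr mulr_ge0 ?(ltW kappa_gt0)// fine_ge0//.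
  exact: inf_cbox_ge0.
- move=> a l a' l' Ha Ha' sub; rewrite lerD2r ler_pM2l// fine_le ?inf_fin//.
  by apply/ereal_inf_le_tmp/image_subset.
- move=> a l Ha; apply: le_trans (hc a l Ha); apply: le_measure; rewrite ?inE.
  + exact: measurable_far.
  + apply: measurableI; first exact: measurable_cbox.
    rewrite (_ : [set _ | _] =
      deviation g (c a l) (kappa * fine (inf_cbox a l))).
      exact: measurable_deviation.
    by apply/seteqP; split => z; rewrite /deviation /= -lte_fin EFinM fineK ?inf_fin.
  + move=> z [za]; rewrite /deviation /= => far; split => //=.
    rewrite -(fineK (inf_fin _ _ Ha)) -EFinM lte_fin; apply: le_lt_trans far.
    by rewrite /osc lerDl ltW.
- move=> a l z Ha za; apply: le_trans (Psi_ge z (Ha.2 z (box_cbox za))).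
  rewrite -poweR_EFin oscE//; apply: le_poweR.
  + exact: ltW.
  + by rewrite adde_ge0 ?lee_fin ?(ltW eps0)// mule_ge0 ?inf_cbox_ge0// lee_fin ltW.
  + rewrite leeD2r// lee_wpmul2l ?lee_fin ?(ltW kappa_gt0)//.
    by apply: ereal_inf_lbound; exists z => //; exact: box_cbox.
Qed.

Variable h : E -> R.
Hypothesis mh : measurable_fun [set: E] h.
Hypothesis h_ge0 : forall z, 0 <= h z.
Variable r : R.
Hypothesis r_gt0 : 0 < r.
Hypothesis Mr_le : forall z (B : \bar R), top z -> (0 <= B)%E ->
  (forall u m, 0 < m -> cbox u m z ->
    (\int[mu]_(x in cbox u m) (h x)%:E <= (m ^+ n)%:E * B)%E) ->
  (Mr z <= B `^ r^-1)%E.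

Definition majorant_constant (v : R) : R :=
  local_constant (n := n) s p *
  (2 `^ p * (kappa `^ p * ((6 ^+ n) `^ (p / r) * (2 ^+ n * (6 ^+ n * v))) + 1)).

(** The sum over the shifted grids of the dyadic maximal functions, to the power
    p / r, dominates Mr^p; it serves as the majorant, with eps = theta. *)
Lemma oscillation_le (y : E) (lam theta v : R) : top y -> 0 < lam -> 0 < theta ->
  (forall u m, 0 < m -> cbox u m y ->
    (\int[mu]_(x in cbox u m) (h x)%:E <= (lam * m ^+ n)%:E)%E) ->
  (forall w : dir, (\int[mu]_(z in box (shifted_corner a0 l0 w) (6 * l0))
     pathsup K h (fun x : R => (x `^ (p / r))%R) lam (shifted_corner a0 l0 w) (6 * l0) z <=
     (v * theta `^ p * (6 * l0) ^+ n)%:E)%E) ->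
  exists c : R, (\int[mu]_(z in top) (`|g z - c| `^ p)%:E <=
    (majorant_constant v * theta `^ p * l0 ^+ n)%:E)%E.
Proof.
move=> ytop lam0 theta0 avg pathsup_le; set q := p / r.
have q0 : 0 < q by rewrite divr_gt0.
pose P w z := pathsup K h (fun x : R => (x `^ q)%R) lam (shifted_corner a0 l0 w) (6 * l0) z.
have w_homo x x' : 0 < x -> x <= x' -> x `^ q <= x' `^ q.
  by move=> x0 xx'; apply: le_powR => //; exact: ltW.
have P_ge N w z : ((pathmax K (boxmean K h) N lam (shifted_corner a0 l0 w) (6 * l0) z
    `^ q)%:E <= P w z)%E.
  exact: (pathsup_ge K h w_homo N _ _ z lam0).
have P_ge0 w z : (0 <= P w z)%E.
  by apply: le_trans (P_ge 0%N w z); rewrite lee_fin powR_ge0.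
have mP w : measurable_fun [set: E] (P w).
  by apply: measurable_pathsup => //; exact: measurable_powR.
pose S z := (\sum_(w : dir) P w z)%E.
have mS : measurable_fun [set: E] S by exact: emeasurable_sum.
have S_ge0 z : (0 <= S z)%E by apply: sume_ge0.
pose k6 := (6 ^+ n : R) `^ q.
have k60 : 0 < k6 by rewrite powR_gt0 ?exprn_gt0.
have k6S_ge0 z : (0 <= k6%:E * S z)%E by rewrite mule_ge0// lee_fin ltW.
have Mr_S z : top z -> (Mr z `^ p <= k6%:E * S z)%E.
  move=> ztop; have Bge0 : (0 <= (k6%:E * S z) `^ q^-1)%E by exact: poweR_ge0.
  apply: (@le_trans _ _ ((((k6%:E * S z) `^ q^-1) `^ r^-1) `^ p)%E).
    apply: le_poweR; [exact: ltW|exact: Mr_ge0|].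
    apply: Mr_le => // u m m0 zu.
    have [w [N uN]] := average_le_pathmax mh h_ge0 l0_gt0 lam0 ytop ztop avg m0 zu.
    apply: (le_trans uN); rewrite mulrC EFinM lee_pmul2l ?lte_fin ?exprn_gt0//.
    set x := pathmax _ _ _ _ _ _ _.
    have x0 : 0 <= x by apply: le_trans (pathmax_ge _ _ _ _ _ _ _); exact: ltW.
    have -> : (6 ^+ n * x)%:E = ((6 ^+ n * x)%:E `^ q `^ q^-1)%E.
      rewrite -poweRrM mulfV ?gt_eqF// poweRe1// lee_fin mulr_ge0 ?exprn_ge0//.
    apply: le_poweR; [by rewrite invr_ge0 ltW|exact: poweR_ge0|].
    rewrite poweR_EFin powRM ?exprn_ge0// EFinM lee_pmul2l ?lte_fin//.
    apply: (le_trans (P_ge N w z)).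
    by rewrite /S (bigD1 w)//= leeDl// sume_ge0.
  rewrite -!poweRrM (_ : q^-1 * (r^-1 * p) = 1) ?poweRe1//.
  by rewrite /q; field; rewrite !gt_eqF.
pose Psi z := ((2 `^ p)%:E * ((kappa `^ p)%:E * (k6%:E * S z) + (theta `^ p)%:E))%E.
have mk6S : measurable_fun [set: E] (fun z => k6%:E * S z)%E.
  exact: measurable_funeM.
have mkk6S : measurable_fun [set: E] (fun z => (kappa `^ p)%:E * (k6%:E * S z))%E.
  exact: measurable_funeM.
have kk6S_ge0 z : (0 <= (kappa `^ p)%:E * (k6%:E * S z))%E.
  by rewrite mule_ge0// lee_fin powR_ge0.
have min : measurable_fun [set: E]
    (fun z => (kappa `^ p)%:E * (k6%:E * S z) + (theta `^ p)%:E)%E.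
  by apply: emeasurable_funD => //; exact: measurable_cst.
have mPsi : measurable_fun [set: E] Psi by exact: measurable_funeM.
have in_ge0 z : (0 <= (kappa `^ p)%:E * (k6%:E * S z) + (theta `^ p)%:E)%E.
  by rewrite adde_ge0// lee_fin powR_ge0.
have Psi_ge0 z : (0 <= Psi z)%E by rewrite mule_ge0// lee_fin powR_ge0.
have mtop : measurable top by exact: measurable_cbox.
have int_P w : (\int[mu]_(z in top) P w z <= (v * theta `^ p * (6 * l0) ^+ n)%:E)%E.
  apply: le_trans (pathsup_le w); apply: ge0_subset_integral.
  - exact: mtop.
  - exact: measurable_box.
  - exact: measurable_funTS.
  - by move=> z _; exact: P_ge0.
  - exact: shifted_box.
have int_S : (\int[mu]_(z in top) S z <=
    (2 ^+ n * (v * theta `^ p * (6 * l0) ^+ n))%:E)%E.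
  rewrite /S (ge0_integral_sum mu mtop); last 2 first.
  - by move=> w; exact: measurable_funTS.
  - by [].
  apply: (@le_trans _ _ (\sum_(w : dir) (v * theta `^ p * (6 * l0) ^+ n)%:E)%E).
    by apply: lee_sum => w _; exact: int_P.
  by rewrite sumEFin sumr_const card_dir -natrX (mulr_natl _ (2 ^ n)%N).
have int_Psi : (\int[mu]_(z in top) Psi z <=
   (2 `^ p * (kappa `^ p * ((6 ^+ n) `^ q * (2 ^+ n * (6 ^+ n * v))) + 1)
      * (theta `^ p * l0 ^+ n))%:E)%E.
  rewrite /Psi (ge0_integralZl mu mtop (measurable_funTS min)); last 2 first.
  - by move=> z _.
  - by rewrite lee_fin powR_ge0.
  rewrite -mulrA EFinM lee_pmul2l ?lte_fin ?powR_gt0//.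
  rewrite (ge0_integralD mu mtop _ (measurable_funTS mkk6S) _ _)//; last first.
    by move=> z _; rewrite lee_fin powR_ge0.
  rewrite (ge0_integralZl mu mtop (measurable_funTS mk6S)); last 2 first.
  - by move=> z _.
  - by rewrite lee_fin powR_ge0.
  rewrite (ge0_integralZl mu mtop (measurable_funTS mS)); last 2 first.
  - by move=> z _.
  - by rewrite lee_fin ltW.
  rewrite integral_cst// mu_cbox// mulrDl mul1r EFinD -!EFinM; apply: leeD => //.
  have -> : kappa `^ p * ((6 ^+ n) `^ q * (2 ^+ n * (6 ^+ n * v))) * (theta `^ p * l0 ^+ n)
      = kappa `^ p * (k6 * (2 ^+ n * (v * theta `^ p * (6 * l0) ^+ n))).
    by rewrite /k6 [(6 * l0) ^+ n]exprMn; ring.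
  rewrite EFinM lee_pmul2l ?lte_fin ?powR_gt0// EFinM lee_pmul2l ?lte_fin//.
have [||c hc] := oscillation_by_majorant theta0 mPsi Psi_ge0.
- move=> z ztop; apply: (@le_trans _ _
    ((2 `^ p)%:E * ((kappa%:E * Mr z) `^ p + (theta `^ p)%:E))%E).
    apply: poweRD_le => //; last exact: ltW.
    by rewrite mule_ge0// lee_fin ltW.
  rewrite /Psi lee_pmul2l ?lte_fin ?powR_gt0// leeD2r//.
  rewrite poweRM ?lee_fin ?(ltW kappa_gt0)// poweR_EFin.
  rewrite lee_pmul2l ?lte_fin ?powR_gt0//; exact: Mr_S.
- exact: le_lt_trans int_Psi (ltry _).
exists c; apply: (le_trans hc).
rewrite -[in leRHS]mulrA /majorant_constant -[in leRHS]mulrA [in leRHS]EFinM.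
apply: lee_wpmul2l => //.
by rewrite lee_fin local_constant_ge0.
Qed.

End oscillation_of_majorized_functions.

(** * The scale L^r log L *)

Section young_function.
Context {R : realType}.

Lemma young_ge0 (r tau : R) : 0 <= tau -> 0 <= young_LrlogL r tau.
Proof. by move=> t0; rewrite mulr_ge0 ?powR_ge0// ln_ge0// lerDl. Qed.

Lemma le_young (r x y : R) : 0 <= r -> 0 <= x -> x <= y ->
  young_LrlogL r x <= young_LrlogL r y.
Proof.
move=> r0 x0 xy; apply: ler_pM; rewrite ?powR_ge0 ?ln_ge0 ?lerDl//.
  exact: le_powR.
by rewrite ler_ln ?posrE ?lerD2l//; lra.
Qed.

(** For tau >= 1 the logarithm of 1 + tau is at least 1/2. *)
Lemma powR_le_young (r tau : R) : 0 <= r -> 0 <= tau ->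
  tau `^ r <= 1 + 2 * young_LrlogL r tau.
Proof.
move=> r0 t0; have [t1|/ltW t1] := leP tau 1.
  apply: (@le_trans _ _ (1 `^ r)); first exact: le_powR.
  by rewrite powR1 lerDl mulr_ge0 ?young_ge0.
have t1_gt0 : 0 < 1 + tau by lra.
have ln_half : 1 <= 2 * ln (1 + tau).
  have := ln_ratio_ge t1_gt0 (@ltr01 R); rewrite invr1 mulr1 addrAC subrr add0r => h1.
  rewrite -(ler_pM2l t1_gt0) mulr1; lra.
apply: (@le_trans _ _ (2 * young_LrlogL r tau)); last by rewrite lerDr.
by rewrite /young_LrlogL mulrCA ler_peMr ?powR_ge0.
Qed.

(** At level 3 theta^r, the quotient (x / theta)^r / 3 is at most (1 + x / theta)^r,
    so the logarithm is at most r ln (1 + x / theta). *)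
Lemma entropy_le_young (r theta x : R) : 0 < theta -> 1 <= r -> 0 <= x ->
  entropy (3 * theta `^ r) (x `^ r) <=
  2 * r * theta `^ r * young_LrlogL r (x / theta) + 3 * theta `^ r.
Proof.
move=> th0 r1 x0; have r0 : 0 <= r by lra.
set lam := _ * _; rewrite /entropy lerD2r.
have lam0 : 0 < lam by rewrite mulr_gt0 ?powR_gt0.
have t0 : 0 <= x / theta by rewrite divr_ge0// ltW.
have xr : x `^ r = theta `^ r * (x / theta) `^ r.
  by rewrite -powRM ?(ltW th0)// mulrC divfK ?gt_eqF.
have -> : 2 * r * theta `^ r * young_LrlogL r (x / theta) =
    2 * x `^ r * (r * ln (1 + x / theta)).
  by rewrite xr /young_LrlogL; ring.
apply: ler_wpM2l; first by rewrite mulr_ge0 ?powR_ge0.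
have [->|xneq0] := eqVneq x 0.
  rewrite powR0 ?gt_eqF//; last by lra.
  by rewrite !mul0r ln0// addr0 ln1 mulr0.
have xp : 0 < x by rewrite lt_neqAle eq_sym xneq0.
rewrite -ln_powR ler_ln ?posrE ?divr_gt0 ?powR_gt0//; last by lra.
rewrite ler_pdivrMr// xr.
rewrite [leRHS](_ : _ = theta `^ r * (3 * (1 + x / theta) `^ r)); last first.
  by rewrite /lam; ring.
rewrite ler_wpM2l ?powR_ge0//.
apply: (@le_trans _ _ ((1 + x / theta) `^ r)); first by apply: le_powR => //; lra.
by rewrite ler_peMl ?powR_ge0// ler1n.
Qed.

End young_function.

Section exceptional_sets.
Context {R : realType} {d} {E : measurableType d} (mu : {measure set E -> \bar R}).

(** Off the exceptional set of u1 and the two null sets, the triangle inequality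
    bounds u - c = u1 + (u2 - c) by A + B. *)
Lemma exceptional_set_le (Q : set E) (u u1 u2 : E -> R) (c s : R) (A B : \bar R) :
  measurable Q -> measurable_fun [set: E] u -> measurable_fun [set: E] u1 ->
  {ae mu, forall z, u z = u1 z + u2 z} ->
  (mu [set z | Q z /\ (A < `|u1 z|%:E)%E] <= s%:E * mu Q)%E ->
  {ae mu, forall z, Q z -> (`|u2 z - c|%:E <= B)%E} ->
  (mu (Q `&` [set z | (A + B < `|u z - c|%:E)%E]) <= s%:E * mu Q)%E.
Proof.
move=> mQ mu_ mu1 [N1 [mN1 N10 sub1]] small [N2 [mN2 N20 sub2]].
have m_abs (v : E -> R) x : measurable_fun [set: E] v ->
    measurable [set z | (x < `|v z|%:E)%E].
  move=> mv; rewrite -[X in measurable X]setTI.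
  apply: emeasurable_fun_o_infty => //.
  by apply/measurable_EFinP; exact: measurableT_comp.
have mA1 : measurable (Q `&` [set z | (A < `|u1 z|%:E)%E]).
  by apply: measurableI => //; exact: m_abs.
have mt : measurable (Q `&` [set z | (A + B < `|u z - c|%:E)%E]).
  apply: measurableI => //; apply: (m_abs (fun z => u z - c)).
  exact: measurable_funB.
apply: le_trans small.
apply: (@le_trans _ _ (mu (Q `&` [set z | (A < `|u1 z|%:E)%E] `|` (N1 `|` N2)))).
  apply: le_measure; rewrite ?inE//.
    by apply: measurableU => //; exact: measurableU.
  move=> z [Qz] /= far.
  have [n1|n1] := pselect (N1 z); first by right; left.
  have [n2|n2] := pselect (N2 z); first by right; right.
  left; split => //=; rewrite ltNge; apply/negP => near1.
  move: far; rewrite ltNge => /negP; apply.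
  have uE : u z = u1 z + u2 z by apply: contrapT => h; apply: n1; exact: sub1.
  have u2B : (`|u2 z - c|%:E <= B)%E.
    by apply: contrapT => h; apply: n2; apply: sub2 => /(_ Qz).
  apply: le_trans (leeD near1 u2B); rewrite -EFinD lee_fin uE -addrA.
  exact: ler_normD.
rewrite (le_trans (measureU2 _ _ _))//; first exact: measurableU.
apply: (@le_trans _ _ (mu (Q `&` [set z | (A < `|u1 z|%:E)%E]) + 0)%E).
  have N12 : (mu N1 + mu N2 <= 0)%E by rewrite N10 N20 adde0.
  by apply: leeD => //; exact: le_trans (measureU2 _ mN1 mN2) N12.
by rewrite adde0.
Qed.

End exceptional_sets.

Section LlogL.
Context {R : realType} {n : nat} {d} {E : measurableType d}
  {mu : {measure set E -> \bar R}} (K : coordinates n mu).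
Notation pt := (n.-tuple R).
Notation box := (box K).
Notation cbox := (cbox K).
Variables (f : E -> R) (r theta : R) (y : E).
Hypotheses (mf : measurable_fun [set: E] f) (r1 : 1 <= r) (theta0 : 0 < theta).
Hypothesis lux : forall u m, 0 < m -> cbox u m y ->
  (\int[mu]_(x in cbox u m) (young_LrlogL r (`|f x| / theta))%:E <= (m ^+ n)%:E)%E.

Let lam := 3 * theta `^ r.
Let h x := `|f x| `^ r.

Let r0 : 0 <= r. Proof. by move: r1; lra. Qed.

Lemma measurable_norm_powR : measurable_fun [set: E] h.
Proof.
apply: (measurableT_comp (measurable_powR r)); exact: measurableT_comp.
Qed.

Lemma measurable_young tau :
  measurable_fun [set: E] (fun x => (young_LrlogL r (`|f x| / tau))%:E).
Proof.
have mt : measurable_fun [set: E] (fun x => `|f x| / tau).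
  by apply: measurable_funM => //; exact: measurableT_comp.
apply/measurable_EFinP; apply: measurable_funM.
  exact: (measurableT_comp (measurable_powR r)).
apply: (measurableT_comp (@measurable_ln R)); exact: measurable_funD.
Qed.

Let mB := measurable_young theta.

Let t_ge0 x : 0 <= `|f x| / theta.
Proof. by rewrite divr_ge0// ltW. Qed.

Lemma LlogL_average u m : 0 < m -> cbox u m y ->
  (\int[mu]_(x in cbox u m) (h x)%:E <= (lam * m ^+ n)%:E)%E.
Proof.
move=> m0 uy; have mQ := measurable_cbox K u m.
have m2B : measurable_fun [set: E]
    (fun x => 2%:E * (young_LrlogL r (`|f x| / theta))%:E)%E.
  exact: measurable_funeM.
have m12B : measurable_fun [set: E]
    (fun x => 1%:E + 2%:E * (young_LrlogL r (`|f x| / theta))%:E)%E.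
  exact: emeasurable_funD.
have B0 x : (0 <= (young_LrlogL r (`|f x| / theta))%:E)%E.
  by rewrite lee_fin young_ge0.
apply: (@le_trans _ _ (\int[mu]_(x in cbox u m)
    ((theta `^ r)%:E * (1%:E + 2%:E * (young_LrlogL r (`|f x| / theta))%:E)))%E).
  apply: ge0_le_integral => //.
  - by move=> x _; rewrite lee_fin powR_ge0.
  - by apply: measurable_funTS; apply/measurable_EFinP; exact: measurable_norm_powR.
  - by apply: measurable_funTS; exact: measurable_funeM.
  move=> x _; rewrite -EFinM lee_fin.
  rewrite /h -[X in X `^ r](divfK (lt0r_neq0 theta0)) mulrC powRM ?(ltW theta0)//.
  by rewrite ler_wpM2l ?powR_ge0// powR_le_young.
rewrite (ge0_integralZl mu mQ (measurable_funTS m12B)); last 2 first.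
- by move=> x _; apply: adde_ge0; [rewrite lee_fin|exact: mule_ge0].
- by rewrite lee_fin powR_ge0.
rewrite (ge0_integralD mu mQ _ _ _ (measurable_funTS m2B))//; last first.
  by move=> x _; rewrite mule_ge0.
rewrite (ge0_integralZl mu mQ (measurable_funTS mB))//.
rewrite integral_cst// mu_cbox// -EFinM.
apply: (@le_trans _ _ ((theta `^ r)%:E * ((1 * m ^+ n)%:E + 2%:E * (m ^+ n)%:E))%E).
  rewrite lee_pmul2l ?lte_fin ?powR_gt0// leeD2l// lee_pmul2l ?lte_fin//.
  exact: lux.
by rewrite -EFinM lee_fin /lam; lra.
Qed.

Definition LlogL_constant := 6 + 2 * r.

Lemma LlogL_pathsup a l : 0 < l -> cbox a l y ->
  (\int[mu]_(z in box a l) pathsup K h (fun x : R => (x `^ 1)%R) lam a l z <=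
    (LlogL_constant * theta `^ r * l ^+ n)%:E)%E.
Proof.
move=> l0 ya; have lam0 : 0 < lam.
  by rewrite mulr_gt0 ?powR_gt0.
have h0 x : 0 <= h x by exact: powR_ge0.
have hoo : (\int[mu]_(z in cbox a l) (h z)%:E < +oo)%E.
  exact: le_lt_trans (LlogL_average l0 ya) (ltry _).
apply: (le_trans (dyadic_maximal_entropy measurable_norm_powR h0 l0 lam0 hoo)).
have mb := measurable_box K a l.
have k0 : 0 <= 2 * r * theta `^ r by rewrite !mulr_ge0 ?powR_ge0.
have mkB : measurable_fun [set: E]
    (fun x => (2 * r * theta `^ r)%:E * (young_LrlogL r (`|f x| / theta))%:E)%E.
  exact: measurable_funeM.
apply: (@le_trans _ _ ((lam * l ^+ n)%:E + \int[mu]_(x in box a l)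
    ((2 * r * theta `^ r)%:E * (young_LrlogL r (`|f x| / theta))%:E + lam%:E))%E).
  rewrite leeD2l//; apply: ge0_le_integral => //.
  - by move=> x _; rewrite lee_fin entropy_ge0.
  - apply: measurable_funTS; apply/measurable_EFinP.
    exact: (measurable_entropy measurable_norm_powR).
  - by apply: measurable_funTS; apply: emeasurable_funD.
  by move=> x _; rewrite -EFinM -EFinD lee_fin entropy_le_young.
rewrite (ge0_integralD mu mb _ (measurable_funTS mkB))//; last 2 first.
- by move=> x _; rewrite mule_ge0 ?lee_fin ?young_ge0.
- by move=> x _; rewrite lee_fin ltW.
rewrite (ge0_integralZl mu mb (measurable_funTS mB)); last 2 first.
- by move=> x _; rewrite lee_fin young_ge0.
- by rewrite lee_fin.
rewrite integral_cst// mu_box// -EFinM.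
apply: (@le_trans _ _ ((lam * l ^+ n)%:E +
    ((2 * r * theta `^ r)%:E * (l ^+ n)%:E + (lam * l ^+ n)%:E))%E).
  rewrite leeD2l// leeD2r// lee_wpmul2l ?lee_fin//.
  apply: le_trans (lux l0 ya); apply: ge0_subset_integral => //.
  - exact: measurable_cbox.
  - exact: measurable_funTS.
  - by move=> x _; rewrite lee_fin young_ge0.
  - exact: box_cbox.
by rewrite -!EFinM -!EFinD lee_fin /lam /LlogL_constant; lra.
Qed.

End LlogL.

(** * Maximal functions on the Euclidean space *)

Section maximal_functions.
Context {R : realType} {n : nat}.
Notation E := (Rn R n).
Notation mu := (@lebesgue R n).
Notation cbox := (cbox (Rn_coordinates R n)).

Lemma cube_cbox (a : n.-tuple R) (l : R) : 0 < l -> cube (cbox a l).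
Proof. by move=> l0; exists a, l. Qed.

Lemma average_cbox (a : n.-tuple R) (l : R) (h : E -> R) : 0 < l ->
  average (cbox a l) h =
  (((l ^+ n)^-1)%:E * \int[mu]_(x in cbox a l) (h x)%:E)%E.
Proof.
move=> l0; rewrite /average; congr (_ * _)%E.
by congr (_ ^-1)%:E; rewrite -[RHS]/(fine (l ^+ n)%:E) -(mu_cbox (Rn_coordinates R n) a l0).
Qed.

Lemma average_leP (a : n.-tuple R) (l : R) (h : E -> R) (B : \bar R) : 0 < l ->
  (average (cbox a l) h <= B)%E <->
  (\int[mu]_(x in cbox a l) (h x)%:E <= (l ^+ n)%:E * B)%E.
Proof.
move=> l0; have ln0 : 0 < l ^+ n by rewrite exprn_gt0.
by rewrite average_cbox// lee_pdivrMl.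
Qed.

Lemma average_ge0 Q (h : E -> R) : (forall x, 0 <= h x) -> (0 <= average Q h)%E.
Proof.
move=> h0; rewrite /average mule_ge0//.
  by rewrite lee_fin invr_ge0 fine_ge0.
by apply: integral_ge0 => x _; rewrite lee_fin.
Qed.

Lemma maximal_leP (f : E -> R) z (B : \bar R) :
  (maximal f z <= B)%E <->
  forall u m, 0 < m -> cbox u m z ->
    (\int[mu]_(x in cbox u m) (`|f x|)%:E <= (m ^+ n)%:E * B)%E.
Proof.
split=> [fB u m m0 zu|fB].
  apply/(average_leP _ _ _ m0); apply: le_trans fB.
  apply: ereal_sup_ubound; exists (cbox u m) => //; split => //; exact: cube_cbox.
apply: ge_ereal_sup => _ [Q [[u [m [m0 ->]]] zu] <-].
by apply/(average_leP _ _ _ m0); exact: fB.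
Qed.

Lemma cbox_around (z : E) : exists a : n.-tuple R, cbox a 1 z.
Proof. by exists (z : n.-tuple R) => i; rewrite /= lexx lerDl ler01. Qed.

Lemma maximal_ge0 (f : E -> R) z : (0 <= maximal f z)%E.
Proof.
have [a za] := cbox_around z.
apply: (@le_trans _ _ (average (cbox a 1) (fun y => `|f y|%R))).
  by apply: average_ge0 => x.
by apply: ereal_sup_ubound; exists (cbox a 1) => //; split => //; exact: cube_cbox.
Qed.

Lemma maximal_pow_ge0 r (f : E -> R) z : (0 <= maximal_pow r f z)%E.
Proof. exact: poweR_ge0. Qed.

Lemma maximal_pow_le (r : R) (f : E -> R) z (B : \bar R) : 0 < r -> (0 <= B)%E ->
  (forall u m, 0 < m -> cbox u m z ->
    (\int[mu]_(x in cbox u m) (`|f x| `^ r)%:E <= (m ^+ n)%:E * B)%E) ->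
  (maximal_pow r f z <= B `^ r^-1)%E.
Proof.
move=> r0 B0 fB; apply: le_poweR; first by rewrite invr_ge0 ltW.
  exact: maximal_ge0.
apply/maximal_leP => u m m0 zu.
under eq_integral do rewrite ger0_norm ?powR_ge0//.
exact: fB.
Qed.

Lemma maximal_pow_lt (r theta : R) (f : E -> R) z : 0 < r -> 0 < theta ->
  (maximal_pow r f z < theta%:E)%E ->
  forall u m, 0 < m -> cbox u m z ->
    (\int[mu]_(x in cbox u m) (`|f x| `^ r)%:E <= (theta `^ r * m ^+ n)%:E)%E.
Proof.
move=> r0 th0 fth u m m0 zu.
have : (maximal (fun y => (`|f y| `^ r)%R) z <= (theta `^ r)%:E)%E.
  have -> : maximal (fun y => (`|f y| `^ r)%R) z = (maximal_pow r f z `^ r)%E.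
    by rewrite /maximal_pow -poweRrM mulVf ?gt_eqF// poweRe1// maximal_ge0.
  rewrite -poweR_EFin; apply: le_poweR; [exact: ltW|exact: maximal_pow_ge0|exact: ltW].
move=> /maximal_leP /(_ u m m0 zu).
under eq_integral do rewrite ger0_norm ?powR_ge0//.
by rewrite -EFinM mulrC.
Qed.

(** The Luxemburg infimum is approached by some lam < theta, and B is
    nondecreasing. *)
Lemma luxemburg_lt (r theta : R) (f : E -> R) u m : 0 < m -> 1 <= r ->
  measurable_fun [set: E] f ->
  (luxemburg (young_LrlogL r) f (cbox u m) < theta%:E)%E ->
  (\int[mu]_(x in cbox u m) (young_LrlogL r (`|f x| / theta)%R)%:E <= (m ^+ n)%:E)%E.
Proof.
move=> m0 r1 mf lux.
have [_ [lam [lam0 avg1] <-]] : exists2 x, [set lam%:E | lam in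
    [set lam : R | 0 < lam /\
      (average (cbox u m) (fun y => young_LrlogL r (`|f y| / lam)%R) <= 1)%E]] x
    & (x < theta%:E)%E.
  by have [x xS xth] := ereal_inf_lt lux; exists x.
rewrite lte_fin => lamth; have th0 : 0 < theta by exact: lt_trans lamth.
have mB : forall tau, measurable_fun (cbox u m)
    (fun x => (young_LrlogL r (`|f x| / tau))%:E).
  by move=> tau; apply: measurable_funTS; exact: measurable_young.
move: avg1 => /(average_leP _ _ _ m0); rewrite mule1; apply: le_trans.
apply: ge0_le_integral => //.
- exact: measurable_cbox.
- by move=> x _; rewrite lee_fin young_ge0// divr_ge0// ltW.
move=> x _; rewrite lee_fin le_young//; first by lra.
  by rewrite divr_ge0// ltW.
by rewrite ler_wpM2l// lef_pV2 ?posrE// ltW.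
Qed.

Lemma luxemburg_ge0 (B : R -> R) (f : E -> R) Q : (0 <= luxemburg B f Q)%E.
Proof. by apply: le_ereal_inf_tmp => _ [lam [lam0 _] <-]; rewrite lee_fin ltW. Qed.

Lemma maximal_LrlogL_ge0 r (f : E -> R) z : (0 <= maximal_LrlogL r f z)%E.
Proof.
have [a za] := cbox_around z.
apply: (le_trans (luxemburg_ge0 (young_LrlogL r) f (cbox a 1))).
by apply: ereal_sup_ubound; exists (cbox a 1) => //; split => //; exact: cube_cbox.
Qed.

Lemma luxemburg_le_maximal r (f : E -> R) z u m : 0 < m -> cbox u m z ->
  (luxemburg (young_LrlogL r) f (cbox u m) <= maximal_LrlogL r f z)%E.
Proof.
move=> m0 zu; apply: ereal_sup_ubound.
by exists (cbox u m) => //; split => //; exact: cube_cbox.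
Qed.

Lemma oscillation_le_integral (p C theta : R) (g : E -> R) a l c : 0 < l -> 0 < p ->
  0 <= C -> 0 < theta ->
  (\int[mu]_(z in cbox a l) (`|g z - c| `^ p)%:E <= (C * theta `^ p * l ^+ n)%:E)%E ->
  (oscillation p g (cbox a l) <= ((C `^ p^-1 + 1) * theta)%:E)%E.
Proof.
move=> l0 p0 C0 th0 int_le.
apply: (@le_trans _ _ ((average (cbox a l) (fun y => (`|g y - c| `^ p)%R)) `^ p^-1)%E).
  by apply: ereal_inf_lbound; exists c.
apply: (@le_trans _ _ ((C * theta `^ p)%:E `^ p^-1)%E).
  apply: le_poweR; first by rewrite invr_ge0 ltW.
    by apply: average_ge0 => x; exact: powR_ge0.
  by apply/(average_leP _ _ _ l0); rewrite -EFinM mulrC.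
rewrite poweR_EFin lee_fin powRM ?powR_ge0// -powRrM mulfV ?gt_eqF// powRr1 ?(ltW th0)//.
by rewrite ler_pM2r// lerDl.
Qed.

End maximal_functions.

(** * Oscillation of T f on one cube *)

Section oscillation_bounds.
Context {R : realType} {n : nat} (n_gt0 : (0 < n)%N).
Notation E := (Rn R n).
Notation mu := (@lebesgue R n).
Notation K := (Rn_coordinates R n).
Notation cbox := (cbox (Rn_coordinates R n)).

(** The local oscillation in the sense of John and Stromberg: closeness to a
    constant is asked only off a set of proportion s. *)
Definition weak_oscillation_le (s kappa : R) (g : E -> R) (Mr : E -> \bar R) :=
  forall a l, 0 < l -> exists c : R,
  (mu (cbox a l `&` [set z | (kappa%:E * inf_on (cbox a l) Mr < `|g z - c|%R%:E)%E])
     <= (s * l ^+ n)%:E)%E.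

Variables (r s p kappa : R).
Hypotheses (r_ge1 : 1 <= r) (s0 : 0 < s) (s3 : 3 * s < 1) (p_gt0 : 0 < p).
Hypotheses (p_small : 2 `^ p * (s / (1 - s)) < 1) (kappa_gt0 : 0 < kappa).

Let r_gt0 : 0 < r. Proof. by move: r_ge1; lra. Qed.

Lemma majorant_constant_ge0 v : 0 <= v -> 0 <= majorant_constant (n := n) s p kappa r v.
Proof.
move=> v0; rewrite /majorant_constant mulr_ge0 ?local_constant_ge0//.
by rewrite mulr_ge0 ?powR_ge0// addr_ge0// !mulr_ge0 ?powR_ge0 ?exprn_ge0.
Qed.

Variables (f g : E -> R).
Hypotheses (mf : measurable_fun [set: E] f) (mg : measurable_fun [set: E] g).
Hypothesis dev : weak_oscillation_le s kappa g (maximal_pow r f).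

Lemma oscillation_of_average_bound a l y lam theta v : 0 < l -> cbox a l y ->
  0 < lam -> 0 < theta -> 0 <= v ->
  (forall u m, 0 < m -> cbox u m y ->
    (\int[mu]_(x in cbox u m) (`|f x| `^ r)%:E <= (lam * m ^+ n)%:E)%E) ->
  (forall b m, 0 < m -> cbox b m y -> (\int[mu]_(z in box K b m)
     pathsup K (fun x => (`|f x| `^ r)%R) (fun x : R => (x `^ (p / r))%R) lam b m z <=
     (v * theta `^ p * m ^+ n)%:E)%E) ->
  (oscillation p g (cbox a l) <=
    (((majorant_constant (n := n) s p kappa r v) `^ p^-1 + 1) * theta)%:E)%E.
Proof.
move=> l0 ya lam0 th0 v0 avg path_le.
have h0 (z : E) : 0 <= `|f z| `^ r by exact: powR_ge0.
have [||w|c hc] := @oscillation_le _ _ _ _ _ K n_gt0 (@Rn_dyadic_density R n) a l l0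
  g s p kappa (maximal_pow r f) mg s0 s3 p_gt0 p_small kappa_gt0
  (maximal_pow_ge0 r f) _ _ (measurable_norm_powR r mf) h0 r r_gt0 _
  y lam theta v ya lam0 th0 avg _.
- by move=> b m [m0 _]; exact: dev.
- by move=> z B _ B0 hB; exact: maximal_pow_le.
- apply: path_le; first by rewrite mulr_gt0.
  by apply: box_cbox; exact: shifted_box.
exact: oscillation_le_integral (majorant_constant_ge0 v0) th0 hc.
Qed.

(** A point y of the cube where M_r f nearly attains its infimum supplies the bound
    for the averages around y; the excess over the infimum tends to 0. *)
Lemma oscillation_le_inf a l : p < r -> 0 < l ->
  (oscillation p g (cbox a l) <=
   ((majorant_constant (n := n) s p kappa r (1 - p / r)^-1) `^ p^-1 + 1)%:E *
     inf_on (cbox a l) (maximal_pow r f))%E.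
Proof.
move=> pr l0; set v := (1 - p / r)^-1; set C := _ + 1.
have q0 : 0 < p / r by rewrite divr_gt0.
have q1 : p / r < 1 by rewrite ltr_pdivrMr// mul1r.
have v0 : 0 <= v by rewrite invr_ge0 subr_ge0 ltW.
have C0 : 0 < C by rewrite ltr_wpDl// powR_ge0.
have : (0 <= inf_on (cbox a l) (maximal_pow r f))%E.
  by apply: le_ereal_inf_tmp => _ [z _ <-]; exact: maximal_pow_ge0.
case infE : (inf_on _ _) => [w| |] // w0; last first.
  by rewrite mulry gtr0_sg// mul1e leey.
apply/lee_addgt0Pr => e e0; pose theta := w + e / C.
have eC0 : 0 < e / C by rewrite divr_gt0.
have th0 : 0 < theta by rewrite ltr_wpDl.
have [_ [y ya <-] ylt] : exists2 x, [set maximal_pow r f z | z in cbox a l] x & (x < theta%:E)%E.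
  have lt1 : (inf_on (cbox a l) (maximal_pow r f) < theta%:E)%E.
    by rewrite infE lte_fin ltrDl.
  by have [x xS xth] := ereal_inf_lt lt1; exists x.
have avg := maximal_pow_lt r_gt0 th0 ylt.
apply: le_trans (_ : (C * theta)%:E <= _)%E; last first.
  by rewrite -EFinM -EFinD lee_fin /theta mulrDr mulrCA mulfV ?mulr1 ?gt_eqF.
apply: (@oscillation_of_average_bound a l y (theta `^ r)) => //.
  by rewrite powR_gt0.
move=> b m m0 yb.
have h0 (z : E) : 0 <= `|f z| `^ r by exact: powR_ge0.
have hoo : (\int[mu]_(z in cbox b m) (`|f z| `^ r)%:E < +oo)%E.
  by apply: le_lt_trans (avg b m m0 yb) _; exact: ltry.
have mh := measurable_norm_powR r mf.
have -> : v * theta `^ p * m ^+ n = (theta `^ r) `^ (p / r) / (1 - p / r) * m ^+ n.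
  by rewrite -powRrM mulrCA mulfV ?gt_eqF// mulr1 [v * _]mulrC.
apply: dyadic_maximal_pow => //; first by rewrite q0.
  by rewrite powR_gt0.
rewrite /boxmean ler_pdivrMr ?exprn_gt0// -lee_fin.
have bc : (\int[mu]_(z in box K b m) (`|f z| `^ r)%:E <=
    \int[mu]_(z in cbox b m) (`|f z| `^ r)%:E)%E.
  apply: ge0_subset_integral.
  - exact: measurable_box.
  - exact: measurable_cbox.
  - by apply: measurable_funTS; exact/measurable_EFinP.
  - by move=> z _; rewrite lee_fin.
  - exact: box_cbox.
rewrite fineK; first exact: le_trans bc (avg b m m0 yb).
rewrite ge0_fin_numE; first exact: le_lt_trans hoo.
by apply: integral_ge0 => z _; rewrite lee_fin.
Qed.

End oscillation_bounds.

Section LlogL_oscillation.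
Context {R : realType} {n : nat} (n_gt0 : (0 < n)%N).
Notation E := (Rn R n).
Notation cbox := (cbox (Rn_coordinates R n)).
Variables (r s kappa : R).
Hypotheses (r_ge1 : 1 <= r) (s0 : 0 < s) (s3 : 3 * s < 1).
Hypotheses (r_small : 2 `^ r * (s / (1 - s)) < 1) (kappa_gt0 : 0 < kappa).

Let r_gt0 : 0 < r. Proof. by move: r_ge1; lra. Qed.

(** Here the averages of |f|^r around x itself, and the entropy on the large boxes,
    are bounded through the Luxemburg norms over the cubes that contain x. *)
Lemma oscillation_le_LrlogL (f g : E -> R) a l x :
  measurable_fun [set: E] f -> measurable_fun [set: E] g ->
  weak_oscillation_le s kappa g (maximal_pow r f) -> 0 < l -> cbox a l x ->
  (oscillation r g (cbox a l) <=
   ((majorant_constant (n := n) s r kappa r (LlogL_constant r)) `^ r^-1 + 1)%:E *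
     maximal_LrlogL r f x)%E.
Proof.
move=> mf mg dev l0 xa; set C := _ + 1.
have v0 : 0 <= LlogL_constant r by rewrite addr_ge0// mulr_ge0// ltW.
have C0 : 0 < C by rewrite ltr_wpDl// powR_ge0.
have := maximal_LrlogL_ge0 r f x.
case ME : (maximal_LrlogL r f x) => [w| |] // w0; last first.
  by rewrite mulry gtr0_sg// mul1e leey.
apply/lee_addgt0Pr => e e0; pose theta := w + e / C.
have eC0 : 0 < e / C by rewrite divr_gt0.
have th0 : 0 < theta by rewrite ltr_wpDl.
have lux u m : 0 < m -> cbox u m x ->
    (\int[@lebesgue R n]_(z in cbox u m)
      (young_LrlogL r (`|f z| / theta)%R)%:E <= (m ^+ n)%:E)%E.
  move=> m0 xu; apply: luxemburg_lt => //.
  apply: (le_lt_trans (luxemburg_le_maximal r f m0 xu)).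
  by rewrite ME lte_fin ltrDl.
apply: le_trans (_ : (C * theta)%:E <= _)%E; last first.
  by rewrite -EFinM -EFinD lee_fin /theta mulrDr mulrCA mulfV ?mulr1 ?gt_eqF.
apply: (oscillation_of_average_bound n_gt0 r_ge1 s0 s3 r_gt0 r_small kappa_gt0
  mf mg dev l0 xa (lam := 3 * theta `^ r) _ th0 v0).
- by rewrite mulr_gt0// powR_gt0.
- by move=> u m m0 xu; exact: (LlogL_average mf r_ge1 th0 lux).
- by move=> b m m0 xb; rewrite mulfV ?gt_eqF//; exact: (LlogL_pathsup mf r_ge1 th0 lux).
Qed.

End LlogL_oscillation.

(** The constant on Q is the value of T f2 at the distinguished point of Q, and
    T f = T f1 + T f2 almost everywhere. *)
Lemma splitting_weak_oscillation (R : realType) (n : nat) (r s : R)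
    (X : topologicalLmodType R) (ev T : X -> Rn R n -> R) (S : set X) :
  linear_operator T -> splitting_property ev T s (maximal_pow r) S ->
  exists2 kappa : R, 0 < kappa &
    forall f, S f -> weak_oscillation_le s kappa (T f) (maximal_pow r (ev f)).
Proof.
move=> [mT linT] [_ [c1 [c2 [c10 c20 split]]]].
exists (c1 + c2); first exact: addr_gt0.
move=> f Sf a l l0; set Q := cbox (Rn_coordinates R n) a l.
have cQ : cube Q by exact: cube_cbox.
have [xQ _ /(_ f Sf)[f1 [f2 [fE small bdd]]]] := split Q Q cQ cQ (@subset_refl _ _).
exists (T f2 xQ).
set W := inf_on Q (maximal_pow r (ev f)) in small bdd *.
have W0 : (0 <= W)%E.
  by apply: le_ereal_inf_tmp => _ [z _ <-]; exact: maximal_pow_ge0.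
have muQ : @lebesgue R n Q = (l ^+ n)%:E by exact: (mu_cbox (Rn_coordinates R n)).
have -> : ((c1 + c2)%:E * W = c1%:E * W + c2%:E * W)%E.
  by rewrite EFinD ge0_muleDl// lee_fin ltW.
rewrite EFinM -muQ.
apply: (exceptional_set_le (u1 := T f1) (u2 := T f2)).
- exact: measurable_cbox.
- exact: mT.
- exact: mT.
- have := linT 1 f1 f2; rewrite scale1r -fE; apply: filterS => z ->.
  by rewrite mul1r.
- exact: ltW.
have muT : (0 < @lebesgue R n [set: Rn R n])%E.
  apply: (@lt_le_trans _ _ (@lebesgue R n Q)).
    by rewrite muQ lte_fin exprn_gt0.
  by apply: le_measure; rewrite ?inE//; exact: measurable_cbox.
move: bdd; rewrite /Linfty_norm unlock /= muT => /ess_supP.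
apply: filterS => z + Qz.
by rewrite /= patchE mem_set.
Qed.

(** * The pointwise inequalities *)

Theorem theorem5p2 (R : realType) (n : nat) (hn : (0 < n)%N)
    (r s t : R) (hr : 1 <= r) (hs0 : 0 < s) (hs : s <= 1 / 2)
    (ht : 1 / 2 < t) (hts : t < 1 - s) (hrst : 2 `^ r * (s / (1 - t)) < 1)
    (X : topologicalLmodType R) (ev : X -> Rn R n -> R)
    (hev : function_space ev)
    (T : X -> Rn R n -> R) (hT : linear_operator T)
    (S : set X) (hS : splitting_property ev T s (maximal_pow r) S) :
  (exists cp : R -> R,
    [/\ forall p, 0 < p < r -> 0 < cp p,
        cp p @[p --> r^'-] --> +oo,
        (forall p, 0 < p < r ->
          forall (Q0 : set (Rn R n)) (x : Rn R n) (f : X),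
          cube Q0 -> Q0 x -> S f ->
          (local_sharp p Q0 (T f) x <=
           (cp p)%:E * ereal_sup [set inf_on Q (maximal_pow r (ev f)) |
             Q in cube `&` [set Q | Q x] `&` [set Q | Q `<=` Q0]])%E) &
        (forall p, 0 < p < r ->
          forall (x : Rn R n) (f : X), S f ->
          (sharp p (T f) x <= (cp p)%:E * maximal_pow r (ev f) x)%E)]) /\
  (exists c : R, 0 < c /\
    forall (x : Rn R n) (f : X), S f ->
      (sharp r (T f) x <= c%:E * maximal_LrlogL r (ev f) x)%E).
Proof.
have s_lt_t : s < t by lra.
have t1 : 0 < 1 - t by lra.
have s1 : 0 < 1 - s by lra.
have st0 : 0 <= s / (1 - t) by rewrite divr_ge0 ?ltW.
have s3 : 3 * s < 1.
  have two_r : 2 <= 2 `^ r.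
    by rewrite -[leLHS](powRr1 (ltW (@ltr0n R 2))) ler_powR// ler1n.
  have : 2 * (s / (1 - t)) < 1 by apply: le_lt_trans hrst; rewrite ler_wpM2r.
  rewrite mulrA ltr_pdivrMr//; lra.
have small p : p <= r -> 2 `^ p * (s / (1 - s)) < 1.
  move=> pr; apply: le_lt_trans hrst; apply: ler_pM.
  - exact: powR_ge0.
  - by rewrite divr_ge0 ?ltW.
  - by rewrite ler_powR// ler1n.
  - by rewrite ler_wpM2l ?(ltW hs0)// lef_pV2 ?posrE//; lra.
have r0 : 0 < r by lra.
have [kappa kappa0 dev] := splitting_weak_oscillation hT hS.
have [_ mev _] := hev; have [mT _] := hT.
split; last first.
  pose C := (majorant_constant (n := n) s r kappa r (LlogL_constant r)) `^ r^-1 + 1.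
  exists C; split; first by rewrite ltr_wpDl// powR_ge0.
  move=> x f Sf; apply: ge_ereal_sup => _ [_ [[a [l [l0 ->]]] xa] <-].
  exact: (oscillation_le_LrlogL hn hr hs0 s3 (small r (lexx r)) kappa0
    (mev f) (mT f) (dev f Sf) l0 xa).
pose C p := (majorant_constant (n := n) s p kappa r (1 - p / r)^-1) `^ p^-1 + 1.
have C0 p : 0 < C p by rewrite ltr_wpDl// powR_ge0.
(* Enlarging a constant keeps it valid; the second term forces the blow-up at r. *)
pose cp p := C p + (r - p)^-1.
have C_cp p : p < r -> C p <= cp p.
  by move=> pr; rewrite lerDl invr_ge0 subr_ge0 ltW.
have inf_ge0 Q f : (0 <= inf_on Q (maximal_pow r (ev f)))%E.
  by apply: le_ereal_inf_tmp => _ [z _ <-]; exact: maximal_pow_ge0.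
have osc p f a l : 0 < p < r -> S f -> 0 < l ->
    (oscillation p (T f) (tuple_cube a l : set (Rn R n)) <=
     (cp p)%:E * inf_on (tuple_cube a l : set (Rn R n)) (maximal_pow r (ev f)))%E.
  move=> /andP[p0 pr] Sf l0; apply: (@le_trans _ _
      ((C p)%:E * inf_on (tuple_cube a l : set (Rn R n)) (maximal_pow r (ev f)))%E).
    exact: (oscillation_le_inf hn hr hs0 s3 p0 (small p (ltW pr)) kappa0
      (mev f) (mT f) (dev f Sf) a pr l0).
  by apply: lee_wpmul2r => //; rewrite lee_fin C_cp.
exists cp; split.
- by move=> p /andP[_ pr]; exact: lt_le_trans (C_cp p pr).
- apply/cvgryPge => A.
  have e0 : 0 < (`|A| + 1)^-1 by rewrite invr_gt0 ltr_wpDl.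
  near=> p.
  have pr : p < r by near: p; exact: nbhs_left_lt.
  have rp : r - p < (`|A| + 1)^-1.
    rewrite ltrBlDr -ltrBlDl; near: p; apply: nbhs_left_gt.
    by rewrite ltrBlDr ltrDl.
  have rp0 : 0 < r - p by rewrite subr_gt0.
  apply: (@le_trans _ _ (r - p)^-1); last by rewrite lerDr ltW.
  apply: (@le_trans _ _ (`|A| + 1)); first by rewrite (le_trans (ler_norm A))// lerDl.
  by rewrite -[leLHS]invrK lef_pV2 ?posrE// ltW.
- move=> p pr Q0 x f _ _ Sf; apply: ge_ereal_sup => _ [Q [[[a [l [l0 QE]]] xQ] QQ0] <-].
  rewrite QE; apply: (le_trans (osc p f a l pr Sf l0)).
  apply: lee_wpmul2l.
    by rewrite lee_fin; move: pr => /andP[_ pr]; apply: le_trans (C_cp p pr); exact: ltW.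
  apply: ereal_sup_ubound; rewrite -QE; exists Q => //; split => //; split => //.
  by exists a, l.
- move=> p pr x f Sf; apply: ge_ereal_sup => _ [Q [[a [l [l0 QE]]] xQ] <-].
  rewrite QE; apply: (le_trans (osc p f a l pr Sf l0)).
  apply: lee_wpmul2l.
    by rewrite lee_fin; move: pr => /andP[_ pr]; apply: le_trans (C_cp p pr); exact: ltW.
  by apply: ereal_inf_lbound; rewrite -QE; exists x.
Unshelve. all: by end_near. Qed.
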